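(* For every $\varepsilon \in (0,1/2]$, there is an algorithm running in time $\mathrm{poly}(1/\varepsilon, n)$ that decides whether a given 3-CNF on $n$ variables has at least $(1/2+\varepsilon)\cdot 2^n$ satisfying assignments. Moreover, given any 3-CNF with at least $(1/2+\varepsilon)\cdot 2^n$ satisfying assignments, the algorithm reports the exact number of its satisfying assignments.
   Context: A 3-CNF is a conjunction of clauses (disjunctions of literals), each containing at most 3 literals. *)

(* Defs.v *)
From HB Require Import structures.
From mathcomp Require Import all_boot all_order all_algebra.
From mathcomp Require Import reals.
Set Implicit Arguments.
Unset Strict Implicit.
Unset Printing Implicit Defensive.

Definition literal (n : nat) : Type := ('I_n * bool)%type.
Definition clause (n : nat) : Type := seq (literal n).
Definition cnf (n : nat) : Type := seq (clause n).
Definition assignment (n : nat) : Type := {ffun 'I_n -> bool}.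

(* (i, true) is the literal x_i and (i, false) its negation. *)
Definition sat_literal n (a : assignment n) (l : literal n) : bool :=
  a l.1 == l.2.
Definition sat_clause n (a : assignment n) (c : clause n) : bool :=
  has (sat_literal a) c.
Definition sat_cnf n (a : assignment n) (f : cnf n) : bool :=
  all (sat_clause a) f.

Definition count_sat n (f : cnf n) : nat :=
  #|[set a : {ffun 'I_n -> bool} | sat_cnf a f]|.

(* No clause is listed twice, so that a 3-CNF on n variables has O(n^3)
   clauses; otherwise its length would not be bounded in terms of n and it
   could not even be read in time poly(n).  A clause may be empty, repeat a
   literal, or contain complementary literals. *)
Definition is_3cnf n (f : cnf n) : bool :=
  uniq f && all (fun c => size c <= 3) f.

(* The machine model is a deterministic first-order call-by-value language over
   binary trees: a program is a finite table of mutually recursive unary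
   functions, the one of index 0 being the entry point.  Variables are de Bruijn
   indices; in [Case e e0 e1] the branch [e1] binds the left subtree as variable
   0 and the right one as variable 1.  Every evaluation step costs one unit.
   As the only primitives are allocating a node, testing for a leaf and
   following a child pointer, a step takes constant time on a pointer machine
   with shared subtrees, so that running times agree with those of Turing
   machines up to a polynomial (N. D. Jones, Computability and Complexity from
   a Programming Perspective, MIT Press, 1997). *)
Inductive tree : Type := Leaf | Node of tree & tree.

Inductive expr : Type :=
  | Var of nat
  | Nil
  | Cons of expr & expr
  | Let of expr & expr
  | Case of expr & expr & expr
  | Call of nat & expr.

Definition program : Type := seq expr.

(* [eval P s e v t]: in environment [s], [e] evaluates to [v] in [t] steps. *)
Inductive eval (P : program) : seq tree -> expr -> tree -> nat -> Prop :=
  | EvalVar s i :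
      eval P s (Var i) (nth Leaf s i) 1
  | EvalNil s :
      eval P s Nil Leaf 1
  | EvalCons s e1 e2 v1 v2 t1 t2 :
      eval P s e1 v1 t1 -> eval P s e2 v2 t2 ->
      eval P s (Cons e1 e2) (Node v1 v2) (t1 + t2).+1
  | EvalLet s e1 e2 v1 v2 t1 t2 :
      eval P s e1 v1 t1 -> eval P (v1 :: s) e2 v2 t2 ->
      eval P s (Let e1 e2) v2 (t1 + t2).+1
  | EvalCaseLeaf s e e0 e1 v t1 t2 :
      eval P s e Leaf t1 -> eval P s e0 v t2 ->
      eval P s (Case e e0 e1) v (t1 + t2).+1
  | EvalCaseNode s e e0 e1 l r v t1 t2 :
      eval P s e (Node l r) t1 -> eval P [:: l, r & s] e1 v t2 ->
      eval P s (Case e e0 e1) v (t1 + t2).+1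
  | EvalCall s f e u v t1 t2 :
      eval P s e u t1 -> eval P [:: u] (nth Nil P f) v t2 ->
      eval P s (Call f e) v (t1 + t2).+1.

Lemma eval_det P s e v t v' t' :
  eval P s e v t -> eval P s e v' t' -> v = v' /\ t = t'.
Proof.
move=> H; elim: H v' t' => {s e v t}; intros; match goal with
  H : eval _ _ _ ?v' ?t' |- _ = ?v' /\ _ = ?t' => inversion H; subst
end => //; repeat match goal with
  | IH : (forall v t, eval ?P ?s ?e v t -> _), H : eval ?P ?s ?e _ _ |- _ =>
      case: (IH _ _ H) => ? ?; clear H; subst
  | H : Node _ _ = Node _ _ |- _ => case: H => ? ?; subst
  end => //.
Qed.

Definition runs (P : program) (input output : tree) (t : nat) : Prop :=
  eval P [:: input] (nth Nil P 0) output t.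

Definition enc_bool (b : bool) : tree := if b then Node Leaf Leaf else Leaf.
Definition enc_seq (T : Type) (enc : T -> tree) (s : seq T) : tree :=
  foldr (fun x => Node (enc x)) Leaf s.

(* Unary, which is harmless: the encoding of a 3-CNF on n variables has size
   polynomial in n. *)
Definition enc_nat (k : nat) : tree := iter k (Node Leaf) Leaf.

Definition enc_literal n (l : literal n) : tree :=
  Node (enc_nat l.1) (enc_bool l.2).

(* The number of variables is part of the input, as some variables might not
   occur in any clause. *)
Definition enc_cnf n (f : cnf n) : tree :=
  Node (enc_nat n) (enc_seq (enc_seq (@enc_literal n)) f).

(* Binary numbers, least significant bit first. *)
Definition bits_value (bs : seq bool) : nat :=
  foldr (fun (b : bool) m => b + m.*2) 0 bs.
Definition is_binary (v : tree) (m : nat) : Prop :=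
  exists2 bs : seq bool, v = enc_seq enc_bool bs & bits_value bs = m.

(* Output conventions: [Leaf] is the answer no, [Node Leaf v] the answer yes
   together with a number v in binary. *)
Definition answers_no (out : tree) : Prop := out = Leaf.
Definition answers_yes_with (out : tree) (m : nat) : Prop :=
  exists2 v : tree, out = Node Leaf v & is_binary v m.

(* Main.v *)
Require Import Defs.
From HB Require Import structures.
From mathcomp Require Import all_boot all_order all_algebra.
From mathcomp Require Import reals zify ring lra.
Set Implicit Arguments.
Unset Strict Implicit.
Unset Printing Implicit Defensive.
Import Order.TTheory GRing.Theory Num.Theory.
Import Defs.

(** The algorithm searches for a clause of size 3, failing that of size 2, branches on all
    its variables, and goes on with both restricted formulas. It may choose [16 m + 6]
    clauses along a path, where [(3/4)^m < eps]; once only clauses of size at most 1 are left,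
    the count is 0 or a power of 2. If no path exhausts its budget, the sum of these counts
    is exact. If some path does, the clauses chosen along it have pairwise disjoint
    variables, and the answer is no: six of size 3 leave a fraction of at most
    [(7/8)^6 < 1/2] of the assignments; otherwise at most 15 literals were assumed before the
    first choice of a clause of size 2, so that by the pigeonhole principle [m] of the chosen
    clauses [D_i] of size 2 come from clauses [l \/ D_i] with one common literal [l] (or
    from clauses [D_i]), and the fraction is at most [1/2 + (3/4)^m].

    The exact count is a sum of boundedly many powers of 2. After division by [2^n], such
    sums leave a gap below [1/2 + eps], so that comparing with a suitable dyadic rational,
    built into the program, decides the threshold for every [n]. *)

(** * Fractions of assignments satisfying clauses on disjoint variables *)

Section Counting.
Variable n : nat.
Implicit Types (a : assignment n) (l k : literal n) (c p : clause n).
Implicit Types (f F : cnf n) (Q : pred (assignment n)) (x : 'I_n).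

Definition neg l : literal n := (l.1, ~~ l.2).

Lemma negK : involutive neg.
Proof. by case=> x b; rewrite /neg negbK. Qed.

Lemma neg_eq l k : (neg l == k) = (l == neg k).
Proof. by rewrite -(inj_eq (inv_inj negK)) negK. Qed.

Lemma sat_literal_neg a l : sat_literal a (neg l) = ~~ sat_literal a l.
Proof. by rewrite /sat_literal /=; case: (a _) l.2 => [] []. Qed.

Definition nsat Q : nat := #|[set a : {ffun 'I_n -> bool} | Q a]|.

Lemma eq_nsat Q Q' : Q =1 Q' -> nsat Q = nsat Q'.
Proof. by move=> e; congr #|pred_of_set _|; apply/setP => a; rewrite !inE e. Qed.

Lemma leq_nsat Q Q' : (forall a, Q a -> Q' a) -> nsat Q <= nsat Q'.
Proof. by move=> h; apply/subset_leq_card/subsetP => a; rewrite !inE; apply: h. Qed.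

Lemma nsatT : nsat xpredT = 2 ^ n.
Proof.
rewrite /nsat (_ : [set a : {ffun _ -> _} | true] = setT); last by apply/setP => a; rewrite !inE.
by rewrite cardsT card_ffun card_bool card_ord.
Qed.

Lemma nsat_split Q l :
  nsat Q = nsat (fun a => Q a && sat_literal a l)
         + nsat (fun a => Q a && sat_literal a (neg l)).
Proof.
rewrite /nsat -(cardsID [set a | sat_literal a l]); congr (_ + _);
  by congr #|pred_of_set _|; apply/setP => a; rewrite !inE ?sat_literal_neg 1?andbC.
Qed.

Lemma nsatU Q Q1 Q2 : (forall a, Q a -> Q1 a || Q2 a) -> nsat Q <= nsat Q1 + nsat Q2.
Proof.
move=> h; apply: (leq_trans _ (leq_card_setU _ _)).
by apply/subset_leq_card/subsetP => a; rewrite !inE; apply: h.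
Qed.

Definition flip x a : assignment n := [ffun i => a i (+) (i == x)].

Lemma flipK x : involutive (flip x).
Proof. by move=> a; apply/ffunP => i; rewrite !ffunE -addbA addbb addbF. Qed.

Definition indep x Q := forall a, Q (flip x a) = Q a.

Lemma sat_literal_flip a l x :
  sat_literal (flip x a) l = sat_literal a l (+) (l.1 == x).
Proof. by rewrite /sat_literal ffunE; case: (a _) l.2 (_ == x) => [] [] []. Qed.

(** Flipping the variable of [l] is an involution that preserves [Q] and exchanges the two parts of
    [nsat_split]. *)
Lemma nsat_half Q l : indep l.1 Q -> nsat (fun a => Q a && sat_literal a l) * 2 = nsat Q.
Proof.
move=> iQ; rewrite muln2 -addnn (nsat_split Q l); congr (_ + _).
rewrite /nsat -(card_imset _ (inv_inj (flipK l.1))); congr #|pred_of_set _|.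
apply/setP => a; rewrite inE -[in LHS](flipK l.1 a) mem_imset; last exact: inv_inj (flipK _).
by rewrite inE iQ sat_literal_neg sat_literal_flip eqxx addbT.
Qed.

Lemma nsat_literals Q c :
    uniq (map fst c) -> (forall l, l \in c -> indep l.1 Q) ->
  nsat (fun a => Q a && all (sat_literal a) c) * 2 ^ size c = nsat Q.
Proof.
elim: c Q => [|l c IH] Q /=.
  by move=> _ _; rewrite muln1; apply: eq_nsat => a; rewrite andbT.
case/andP => lc uc ic; rewrite -(@nsat_half Q l); last exact/ic/mem_head.
rewrite -[in RHS]IH // => [|k kc a]; last first.
  rewrite ic ?inE ?kc ?orbT // sat_literal_flip.
  case: eqP lc => [->|_ _].
    by rewrite map_f.
  by rewrite addbF.
rewrite expnSr mulnA; congr (_ * _ * _).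
by apply: eq_nsat => a; rewrite /= andbA.
Qed.

(** A clause fails exactly when the negations of all its literals hold, and [nsat_literals] gives
    the fraction of [Q] lost in this way. *)
Lemma nsat_clause Q c :
    uniq (map fst c) -> (forall l, l \in c -> indep l.1 Q) ->
  nsat (fun a => Q a && sat_clause a c) * 2 ^ size c = nsat Q * (2 ^ size c - 1).
Proof.
move=> uc ic; have := @nsat_literals Q (map neg c).
rewrite -map_comp size_map => /(_ uc) => H.
have {}H := H (fun l => ltac:(by case/mapP => k kc ->; exact: ic k kc)).
rewrite mulnBr muln1 -{2}H -mulnBl; congr (_ * _).
apply/eqP; rewrite eq_sym; apply/eqP.
rewrite -{1}[nsat Q]addn0; apply: (canLR (addnK _)); rewrite addn0.
rewrite /nsat -(cardsID [set a | sat_clause a c]); congr (_ + _);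
  congr #|pred_of_set _|; apply/setP => a; rewrite !inE //.
rewrite andbC all_map /sat_clause -all_predC; congr (_ && _).
by apply: eq_all => l; rewrite /= sat_literal_neg.
Qed.

Definition vdisjoint c1 c2 := ~~ has (mem (map fst c1)) (map fst c2).

Lemma indep_sat_clause x c : x \notin map fst c -> indep x (fun a => sat_clause a c).
Proof.
move=> xc a; apply: eq_in_has => l lc; rewrite sat_literal_flip.
by case: eqP xc => [<-|_ _]; rewrite ?map_f // addbF.
Qed.

(** Clauses on disjoint variables behave as independent events of probability [1 - 2^-w]: flipping a
    variable of one does not affect the others. *)
Lemma nsat_disjoint w f :
    all (fun c => uniq (map fst c) && (size c == w)) f -> pairwise vdisjoint f ->
  nsat (fun a => sat_cnf a f) * 2 ^ (w * size f) = 2 ^ n * (2 ^ w - 1) ^ size f.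
Proof.
elim: f => [|c f IH] /=; first by rewrite muln0 !muln1 nsatT.
case/andP => /andP[uc /eqP sc] af /andP[/allP dc df].
rewrite mulnS expnD expnSr mulnA.
rewrite (@eq_nsat _ (fun a => sat_cnf a f && sat_clause a c)) => [|a]; last first.
  by rewrite /= andbC.
rewrite -{1}sc nsat_clause // ?sc; first by rewrite mulnAC IH // mulnA.
move=> l lc a; apply: eq_in_all => d df'; apply: indep_sat_clause.
have /hasPn := dc d df'; rewrite /vdisjoint => h.
by apply/negP => /h /=; rewrite map_f.
Qed.

(** * Residual formulas along a path of assumed literals *)

Definition residual F p : cnf n :=
  [seq [seq k <- c | neg k \notin p] | c <- F & ~~ has (mem p) c].

Definition assign l F : cnf n :=
  [seq [seq k <- c | k != neg l] | c <- F & l \notin c].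

Lemma residual_nil F : residual F [::] = F.
Proof.
rewrite /residual; under eq_filter do rewrite has_pred0.
rewrite filter_predT -[RHS]map_id; apply: eq_map => c.
by under eq_filter do rewrite in_nil; rewrite filter_predT.
Qed.

(** [assign] is the step that the program performs, [residual] its accumulated effect. The
    hypothesis ensures that [l] was not erased from any clause, so that looking for [l] in the
    shortened clause or in the original one is the same. *)
Lemma assign_residual F p l : neg l \notin p -> assign l (residual F p) = residual F (l :: p).
Proof.
move=> nlp; rewrite /assign /residual filter_map -map_comp -filter_predI.
rewrite (@eq_filter _ _ (fun c => ~~ has (mem (l :: p)) c)) => [|c].
  apply: eq_map => c /=; rewrite -filter_predI; apply: eq_filter => k /=.
  by rewrite inE negb_or neg_eq.
rewrite /= mem_filter nlp /= -negb_or; congr (~~ _).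
elim: c => //= k c IH; rewrite !inE.
rewrite -orbA -orbCA -[RHS]orbA -IH [l == k]eq_sym.
by case: (k == l); case: (k \in p); rewrite /= ?orbT.
Qed.

Lemma mem_residual F p c : reflect
  (exists d, [/\ d \in F, ~~ has (mem p) d & c = [seq k <- d | neg k \notin p]])
  (c \in residual F p).
Proof.
apply: (iffP mapP) => [[d]|[d [dF dp ->]]].
  by rewrite mem_filter => /andP[dp dF] ->; exists d.
by exists d; rewrite // mem_filter dp.
Qed.

Lemma residual_vars F p c l : c \in residual F p -> l \in c -> l.1 \notin map fst p.
Proof.
case/mem_residual => d [dF /hasPn dp ->]; rewrite mem_filter => /andP[nl ld].
apply/mapP => -[k kp e]; have := dp l ld; rewrite /= => lp.
case: (eqVneq l k) => [lk|lk]; first by rewrite lk kp in lp.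
case/negP: nl; suff -> : neg l = k by [].
case: l k e lk {kp ld lp} => x b [y b'] /= -> ; rewrite xpair_eqE eqxx /neg /=.
by case: b b' => [] [].
Qed.

Definition npath F p := nsat (fun a => all (sat_literal a) p && sat_cnf a F).

Lemma npath_split F p l : npath F p = npath F (l :: p) + npath F (neg l :: p).
Proof.
rewrite /npath (nsat_split _ l); congr (_ + _); apply: eq_nsat => a /=;
  by rewrite andbC andbA.
Qed.

Lemma sat_residual F p a :
  all (sat_literal a) p -> sat_cnf a F = sat_cnf a (residual F p).
Proof.
move=> /allP sp; apply/allP/allP => [h c /mem_residual[d [dF _ ->]]|h d dF].
  have /hasP[l ld sl] := h d dF; apply/hasP; exists l => //.
  rewrite mem_filter ld andbT; apply/negP => /sp; by rewrite sat_literal_neg sl.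
have [/hasP[l ld lp]|dp] := boolP (has (mem p) d); first by apply/hasP; exists l; rewrite ?sp.
have /h/hasP[l] : [seq k <- d | neg k \notin p] \in residual F p by apply/mem_residual; exists d.
by rewrite mem_filter => /andP[_ ld] sl; apply/hasP; exists l.
Qed.

Lemma npathE F p : npath F p = nsat (fun a => all (sat_literal a) p && sat_cnf a (residual F p)).
Proof. by apply: eq_nsat => a; apply: andb_id2l; exact: sat_residual. Qed.

Lemma npath_empty_clause F p : [::] \in residual F p -> npath F p = 0.
Proof.
move=> h; rewrite npathE; apply/eqP; rewrite cards_eq0; apply/eqP/setP => a; rewrite !inE.
by apply/negbTE/negP => /andP[_ /allP/(_ _ h)].
Qed.

Lemma npath_unit F p l : [:: l] \in residual F p -> npath F p = npath F (l :: p).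
Proof.
move=> h; rewrite (npath_split _ _ l) -[RHS]addn0; congr addn.
rewrite /npath /nsat; apply/eqP; rewrite cards_eq0; apply/eqP/setP => a; rewrite !inE.
apply/negbTE/negP => /= /andP[/andP[sl sp]]; rewrite (sat_residual _ sp) => /allP/(_ _ h).
by rewrite /sat_clause /= orbF => sl'; rewrite sat_literal_neg sl' in sl.
Qed.

(** The literals of [p] fix [size p] distinct variables, and nothing constrains the others. *)
Lemma npath_done F p : uniq (map fst p) -> residual F p = [::] -> npath F p = 2 ^ (n - size p).
Proof.
move=> up h; rewrite npathE h.
have sp : size p <= n.
  by have := max_card (mem (map fst p)); rewrite (card_uniqP up) size_map card_ord.
have := @nsat_literals xpredT p up (fun _ _ _ => erefl).
have e : 2 ^ n = 2 ^ (n - size p) * 2 ^ size p by rewrite -expnD subnK.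
rewrite nsatT e => /eqP; rewrite eqn_pmul2r ?expn_gt0 // => /eqP <-.
by apply: eq_nsat => a; rewrite /sat_cnf /= andbT.
Qed.

(** * Normalization to clauses with distinct variables *)

Fixpoint dedup c : clause n :=
  if c is l :: d then l :: [seq k <- dedup d | k != l] else [::].
Fixpoint tautology c : bool :=
  if c is l :: d then (neg l \in d) || tautology d else false.
Definition normalize F : cnf n := [seq dedup c | c <- F & ~~ tautology c].

Lemma mem_dedup c : dedup c =i c.
Proof.
elim: c => //= l c IH k; rewrite !inE mem_filter IH.
by case: (k == l).
Qed.

Lemma size_dedup c : size (dedup c) <= size c.
Proof. by elim: c => //= l c IH; rewrite ltnS (leq_trans _ IH) // size_filter count_size. Qed.

(** Without complementary literals, two literals on the same variable are equal, so removing
    repetitions separates the variables. The exact fractions above require this. *)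
Lemma uniq_dedup c : ~~ tautology c -> uniq (map fst (dedup c)).
Proof.
elim: c => //= l c IH; rewrite negb_or => /andP[nl /IH uc]; apply/andP; split.
  apply/mapP => -[k]; rewrite mem_filter mem_dedup => /andP[kl kc] e.
  case/negP: nl; suff -> : neg l = k by [].
  case: l k e kl {kc} => x b [y b'] /= -> ; rewrite xpair_eqE eqxx /neg /=.
  by case: b b' => [] [].
by apply: subseq_uniq uc; apply/map_subseq/filter_subseq.
Qed.

Lemma sat_tautology a c : tautology c -> sat_clause a c.
Proof.
rewrite /sat_clause; elim: c => //= l c IH /orP[nl|/IH ->]; last by rewrite orbT.
case sl: (sat_literal a l) => //=; apply/hasP; exists (neg l) => //.
by rewrite sat_literal_neg sl.
Qed.

Lemma sat_normalize a F : sat_cnf a (normalize F) = sat_cnf a F.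
Proof.
rewrite /sat_cnf all_map all_filter; apply: eq_all => c /=.
rewrite {1}/sat_clause (eq_has_r (mem_dedup c)).
by case t: (tautology c) => //=; rewrite sat_tautology.
Qed.

Definition normal c := uniq (map fst c) && (size c <= 3).

Lemma normalize_normal F : all (fun c => size c <= 3) F -> all normal (normalize F).
Proof.
move=> /allP h; apply/allP => _ /mapP[c + ->]; rewrite mem_filter => /andP[tc cF].
by rewrite /normal uniq_dedup // (leq_trans (size_dedup c)) ?h.
Qed.

End Counting.

(** * Paths of the search *)

Lemma size_filter_id (T : Type) (P : pred T) s : size s <= size (filter P s) -> filter P s = s.
Proof.
rewrite size_filter => h; apply/all_filterP; rewrite all_count.
by rewrite eqn_leq count_size h.
Qed.

(** The union bound behind the pigeonhole argument: every element is counted for at least one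
    key. *)
Lemma size_leq_sum_count (T S : Type) (P : S -> pred T) (ks : seq S) (s : seq T) :
  all (fun x => has (fun k => P k x) ks) s -> size s <= \sum_(k <- ks) count (P k) s.
Proof.
elim: s => [|x s IH] /=; first by move=> _; apply: leq0n.
case/andP => hx /IH {}IH; rewrite big_split -add1n leq_add //.
elim: ks hx {IH} => //= k ks IH; rewrite big_cons.
by case: (P k x) => //= /IH.
Qed.

Section Search.
Variables (n : nat) (F : cnf n) (B : nat).
Hypothesis normF : all (@normal n) F.
Implicit Types (l k : literal n) (c d p pend : clause n) (b m : nat) (h : cnf n).

(* The states of the search for a 3-CNF: the literals assumed on the current path,
   the literals of the chosen clause that are still to be branched on, and the number of
   clauses that may still be chosen. *)
Inductive reach : clause n -> clause n -> nat -> Prop :=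
  | ReachInit : reach [::] [::] B
  | ReachBranch p l pend b k :
      reach p (l :: pend) b -> k \in [:: l; neg l] -> reach (k :: p) pend b
  | ReachPick3 p b c :
      reach p [::] b.+1 -> c \in residual F p -> size c = 3 -> reach p c b
  | ReachPick2 p b c :
      reach p [::] b.+1 -> all (fun c => size c <= 2) (residual F p) ->
      c \in residual F p -> size c = 2 -> reach p c b
  | ReachUnit p b l :
      reach p [::] b -> all (fun c => size c <= 1) (residual F p) ->
      reach (l :: p) [::] b.

Lemma residual_cat p1 p2 c : c \in residual F (p2 ++ p1) ->
  exists2 d, d \in residual F p1 & c = [seq k <- d | neg k \notin p2].
Proof.
case/mem_residual => d [dF dp ->]; exists [seq k <- d | neg k \notin p1].
  apply/mem_residual; exists d; split=> //; apply: contra dp => /hasP[l ld lp].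
  by apply/hasP; exists l => //; rewrite /= mem_cat; apply/orP; right.
by rewrite -filter_predI; apply: eq_filter => l; rewrite /= mem_cat negb_or.
Qed.

Lemma residual_size p1 p2 w :
  all (fun c => size c <= w) (residual F p1) -> all (fun c => size c <= w) (residual F (p2 ++ p1)).
Proof.
move=> /allP h; apply/allP => c /residual_cat[d dr ->].
by rewrite size_filter (leq_trans (count_size _ _)) ?h.
Qed.

(** Residual clauses only shrink along a path, so one that is as large as any earlier clause has
    lost no literal in between. *)
Lemma residual_maximal p1 p2 c :
    all (fun d => size d <= size c) (residual F p1) -> c \in residual F (p2 ++ p1) ->
  c \in residual F p1.
Proof.
move=> /allP h /residual_cat[d dr e]; rewrite e size_filter_id // -e.
exact: h.
Qed.

Lemma residual_size3 : all (fun c => size c <= 3) (residual F [::]).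
Proof. by rewrite residual_nil; apply: sub_all normF => c /andP[]. Qed.

Lemma residual_uniq p c : c \in residual F p -> uniq (map fst c).
Proof.
case/mem_residual => d [dF _ ->]; have /andP[ud _] := allP normF d dF.
by apply: subseq_uniq ud; apply/map_subseq/filter_subseq.
Qed.

(** The source of disjointness: a clause chosen later avoids the variables of the path, hence those
    of every clause covered by it. *)
Definition covered h c := all (fun d => all (fun l => l.1 \in map fst c) d) h.

Lemma covered_vdisjoint h c d :
  covered h c -> (forall l, l \in d -> l.1 \notin map fst c) -> all (vdisjoint d) h.
Proof.
move=> /allP hc dc; apply/allP => e /hc /allP ec; rewrite /vdisjoint.
apply/hasPn => _ /mapP[l le ->]; apply/mapP => -[k kd kl].
by have := dc k kd; rewrite -kl ec.
Qed.

Lemma covered_sub h c d : {subset map fst c <= map fst d} -> covered h c -> covered h d.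
Proof. by move=> s; apply: sub_all => e; apply: sub_all => l /s. Qed.

Lemma covered_pick h c p : covered h p -> covered (c :: h) (c ++ p).
Proof.
move=> hp; apply/andP; split; first by apply/allP => l lc; rewrite map_cat mem_cat map_f.
by apply: covered_sub hp => x xp; rewrite map_cat mem_cat xp orbT.
Qed.

Lemma covered_branch h p l k pend :
  k \in [:: l; neg l] -> covered h ((l :: pend) ++ p) -> covered h (pend ++ k :: p).
Proof.
move=> kl; apply: covered_sub => x; rewrite /= !map_cat !(inE, mem_cat) /=.
by move: kl; rewrite !inE => /orP[]/eqP ->; rewrite /= orbCA.
Qed.

(* The clauses of size 3 chosen along a path are clauses of [F] that the path had not
   touched. Once there are none left (the path being [p1] at that time), the clauses of
   size 2 that are chosen belong to the residual formula of [p1]. *)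
Definition phase3 h b p pend := [/\ size h + b = B, pairwise (@vdisjoint n) h,
  all (fun c => (c \in F) && (size c == 3)) h,
  size p + size pend = 3 * size h & covered h (pend ++ p)].

Definition phase2 h p1 h2 b p2 pend := [/\ size h + size h2 + b = B,
  pairwise (@vdisjoint n) h, pairwise (@vdisjoint n) h2,
  all (fun c => (c \in F) && (size c == 3)) h &
  [/\ size p1 = 3 * size h, all (fun c => size c <= 2) (residual F p1),
  all (fun c => (c \in residual F p1) && (size c == 2)) h2 & covered h2 (pend ++ p2)]].

(** A chosen clause avoids the variables of the path, which cover all earlier choices of the phase;
    being of maximal size, it has lost no literal since the phase began. Once all clauses have size
    at most 1, this remains so and nothing more is chosen. *)
Lemma reach_phase p pend b : reach p pend b ->
  [\/ exists h, phase3 h b p pend,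
      exists h p1 h2 p2, p = p2 ++ p1 /\ phase2 h p1 h2 b p2 pend |
      pend = [::] /\ all (fun c => size c <= 1) (residual F p)].
Proof.
elim=> {p pend b}.
- by apply: Or31; exists [::].
- move=> p l pend b k _ [[h [e dh ah sp cp]]|[h [p1 [h2 [p2 [-> [e dh dh2 ah [s1 a1 a2 c2]]]]]]]
    |[]//] kl.
  + by apply: Or31; exists h; split=> //; [rewrite /= in sp *; lia | exact: covered_branch cp].
  + apply: Or32; exists h, p1, h2, (k :: p2); split=> //; split=> //; split=> //.
    exact: covered_branch c2.
- move=> p b c _ [[h [e dh ah sp cp]]|[h [p1 [h2 [p2 [-> [e dh dh2 ah [s1 a1 a2 c2]]]]]]]
    |[_ a1]] cr sc.
  + apply: Or31; exists (c :: h); split.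
    * by rewrite /= -addSnnS in e *.
    * rewrite /= dh andbT; apply: covered_vdisjoint cp _ => l; exact: residual_vars cr.
    * rewrite /= ah sc eqxx !andbT -(residual_nil F).
      by apply: (@residual_maximal _ p); rewrite ?cats0 // sc residual_size3.
    * by rewrite /= sc in sp *; lia.
    * exact: covered_pick.
  + by have /allP/(_ c cr) := residual_size p2 a1; rewrite sc.
  + by have := allP a1 c cr; rewrite sc.
- move=> p b c _ [[h [e dh ah sp cp]]|[h [p1 [h2 [p2 [-> [e dh dh2 ah [s1 a1 a2 c2]]]]]]]
    |[_ a1]] ap cr sc.
  + apply: Or32; exists h, p, [:: c], [::]; split=> //; split=> //=; first by lia.
    split=> //=; first by rewrite /= in sp; lia.
      by rewrite cr sc.
    exact: (@covered_pick [::] c [::]).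
  + apply: Or32; exists h, p1, (c :: h2), p2; split=> //; split=> //=; first by lia.
      rewrite dh2 andbT; apply: covered_vdisjoint c2 _ => l lc.
      by have := residual_vars cr lc; rewrite map_cat mem_cat negb_or => /andP[].
    split=> //=; last exact: covered_pick.
    by rewrite a2 sc eqxx !andbT; apply: residual_maximal cr; rewrite sc.
  + by have := allP a1 c cr; rewrite sc.
- move=> p b l _ _ a1; apply: Or33; split=> //.
  exact: (@residual_size p [:: l]).
Qed.

Lemma nsat_sub_disjoint m w h :
    m <= size h -> pairwise (@vdisjoint n) h ->
    all (fun c => uniq (map fst c) && (size c == w)) h ->
  nsat (fun a => sat_cnf a h) * 2 ^ (w * m) <= 2 ^ n * (2 ^ w - 1) ^ m.
Proof.
move=> mh dh uh; have := @nsat_disjoint n w (take m h).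
rewrite size_takel // => <-; first last.
- by apply: subseq_pairwise dh; apply: take_subseq.
- by apply/allP => c /mem_take; apply/allP: c.
rewrite leq_mul2r -{1}(cat_take_drop m h); apply/orP; right.
by apply: leq_nsat => a; rewrite /sat_cnf all_cat => /andP[].
Qed.

(** Clauses of [F] have at most 3 literals, so a residual clause of size 2 has lost at most one, and
    the negation [k] of that one lies on the path. *)
Lemma residual_origin p c : c \in residual F p -> size c = 2 ->
  (c \in F) || has (fun k => has (all (fun l => (l == neg k) || (l \in c))) F) p.
Proof.
case/mem_residual => d [dF _ e] sc; have /andP[_ sd] := allP normF d dF.
have [kd|] := boolP (all (fun k => neg k \notin p) d).
  by rewrite e (all_filterP kd) dF.
case/allPn => k kd; rewrite negbK => kp; apply/orP; right.
apply/hasP; exists (neg k) => //; apply/hasP; exists d => //.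
have := count_predC (fun k => neg k \notin p) d; rewrite -size_filter -e sc => sz.
apply/allP => l ld; rewrite negK; case: eqP => //= lk.
rewrite e mem_filter ld andbT; apply/negP => lp.
have : size [seq l <- d | ~~ (neg l \notin p)] <= 1.
  by rewrite size_filter -ltnS -(ltn_add2l 2) [X in X < _]sz ltnS.
case E : [seq l <- d | ~~ (neg l \notin p)] => [|x [|]] // _.
  by have : k \in [::] by rewrite -E mem_filter negbK kp kd.
have : k \in [:: x] by rewrite -E mem_filter negbK kp kd.
have : l \in [:: x] by rewrite -E mem_filter negbK lp ld.
by rewrite !inE => /eqP ex /eqP ek; case: lk; rewrite ex ek.
Qed.

Lemma reach_stuck m p c :
    B = 16 * m + 6 -> reach p [::] 0 -> c \in residual F p -> 1 < size c ->
  nsat (fun a => sat_cnf a F) * (2 * 4 ^ m) <= 2 ^ n * (4 ^ m + 2 * 3 ^ m).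
Proof.
move=> eB /reach_phase ph cr sc.
(* [X] bounds the excess over half of the assignments; it can be 0 if six clauses of size 3 were
   chosen. *)
suff [k hk] : exists X : nat, X * 4 ^ m <= 2 ^ n * 3 ^ m /\
    nsat (fun a => sat_cnf a F) * 2 <= 2 ^ n + X * 2.
  case: hk => hk hF; rewrite mulnA.
  apply: (leq_trans (leq_mul hF (leqnn _))); nia.
have big3 h : 6 <= size h -> pairwise (@vdisjoint n) h ->
    all (fun c => (c \in F) && (size c == 3)) h ->
    exists X : nat, X * 4 ^ m <= 2 ^ n * 3 ^ m /\
    nsat (fun a => sat_cnf a F) * 2 <= 2 ^ n + X * 2.
  move=> h6 dh ah; exists 0; split=> //; rewrite addn0.
  have := @nsat_sub_disjoint 6 3 h h6 dh.
  have -> : all (fun c => uniq (map fst c) && (size c == 3)) h.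
    by apply: sub_all ah => d /andP[dF ->]; case/andP: (allP normF d dF) => ->.
  move=> /(_ isT).
  have hle : nsat (fun a => sat_cnf a F) <= nsat (fun a => sat_cnf a h).
    apply: leq_nsat => a /allP sF; apply/allP => d dh'; apply: sF.
    by have /andP[] := allP ah d dh'.
  (* What remains amounts to [2 * 7^6 <= 8^6]. *)
  rewrite expnM (_ : 2 ^ 3 = 8) // subSS subn0 !expnS !expn0 !muln1.
  by move: (2 ^ n) => N; lia.
case: ph => [[h [e dh ah _ _]]|[h [p1 [h2 [p2 [ep [e dh dh2 ah [s1 a1 a2 c2]]]]]]]
  |[_ /allP/(_ c cr)]]; last by lia.
  by apply: (big3 h) => //; lia.
case: (leqP 6 (size h)) => h6; first exact: (big3 h).
(* Possible origins of [d]: [None] if it is itself in [F], [Some k] if some clause of [F] has only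
   literals of [d] and possibly [neg k]. *)
pose ori (o : option (literal n)) (d : clause n) := if o is Some k
  then has (all (fun l => (l == neg k) || (l \in d))) F else d \in F.
pose ks := None :: map Some p1.
(* At most 5 clauses of size 3 were chosen, so [p1] has at most 15 literals and there are at most 16
   origins, while [h2] has at least [16 m + 1] clauses. *)
have /hasP[o ok om] : has (fun o => m <= count (ori o) h2) ks.
  apply/negPn/negP; rewrite -all_predC => /allP small.
  have : size h2 <= \sum_(o <- ks) count (ori o) h2.
    apply: size_leq_sum_count; apply/allP => d dh2'; have /andP[dr /eqP sd] := allP a2 d dh2'.
    have := residual_origin dr sd; rewrite /ks /= => /orP[->//|/hasP[k kp kh]].
    by rewrite has_map; apply/orP; right; apply/hasP; exists k.
  apply/negP; rewrite -ltnNge.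
  apply: (@leq_ltn_trans (\sum_(o <- ks) m)).
    rewrite big_seq [leqRHS]big_seq; apply: leq_sum => o /small /=; by rewrite -ltnNge => /ltnW.
  rewrite big_const_seq count_predT iter_addn_0 /= size_map s1; nia.
pose h' := [seq d <- h2 | ori o d].
have dh' : pairwise (@vdisjoint n) h' by apply: subseq_pairwise dh2; apply: filter_subseq.
exists (nsat (fun a => sat_cnf a h')); split.
  have := @nsat_sub_disjoint m 2 h'; rewrite size_filter om dh' => /(_ isT isT).
  rewrite expnM; apply; apply/allP => d; rewrite mem_filter => /andP[_ hd].
  by have /andP[dr ->] := allP a2 d hd; rewrite (residual_uniq dr).
case: o ok @h' {om dh'} => [k|] _ /=; last first.
  apply: leq_trans (leq_addl _ _).
  rewrite leq_mul2r; apply/orP; right; apply: leq_nsat => a /allP sF.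
  by apply/allP => d; rewrite mem_filter => /andP[dF _]; apply: sF.
(* Half of the assignments satisfy [neg k]. In the other half, the clauses of [F] from which those
   of [h'] stem can only be satisfied through [h']. *)
have <- : nsat (fun a => xpredT a && sat_literal a (neg k)) * 2 = 2 ^ n.
  by rewrite nsat_half // nsatT.
rewrite -mulnDl leq_mul2r; apply/orP; right; apply: nsatU => a /allP sF.
case sk: (sat_literal a (neg k)) => //=; apply/allP => d; rewrite mem_filter.
case/andP => /hasP[d' /sF /hasP[l ld sl] /allP/(_ l ld)] /orP[/eqP lk|lc] _.
  by rewrite -lk sl in sk.
by apply/hasP; exists l.
Qed.

End Search.

(** * Binary numbers and the threshold *)

(** Padding with [None] embeds the clauses into the triples over a set of [2 n + 1] elements. *)
Lemma size_3cnf n (f : cnf n) : is_3cnf f -> size f <= (2 * n).+1 ^ 3.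
Proof.
case/andP => uf /allP sf.
pose code (c : clause n) : 3.-tuple (option ('I_n * bool)) :=
  [tuple nth None (map Some c) i | i < 3].
have ic : {in f &, injective code}.
  move=> c d /sf sc /sf sd e; apply: (inj_map (@Some_inj _)).
  have en i : i < 3 -> nth None (map Some c) i = nth None (map Some d) i.
    move=> i3; have := congr1 (fun t => tnth t (Ordinal i3)) e.
    by rewrite !tnth_mktuple.
  apply: (@eq_from_nth _ None); last first.
    by move=> i; rewrite size_map => ic; apply/en/(leq_trans ic).
  (* [None] marks the end of a clause, so agreement in three places bounds one length by the
     other. *)
  have small s t : size s <= 3 -> size t <= 3 ->
      (forall i, i < 3 ->
        nth None (map Some s) i = nth None (map Some t) i :> option ('I_n * bool)) ->
      size (map Some s) <= size (map Some t).
    move=> ss st h; rewrite !size_map leqNgt; apply/negP => ts.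
    have := h (size t); rewrite (leq_trans ts ss) [RHS]nth_default ?size_map // => /(_ isT).
    by case: s {ss h} ts => // x s ts; rewrite (nth_map x).
  by apply/eqP; rewrite eqn_leq !small // => i /en.
have u : uniq (map code f) by rewrite map_inj_in_uniq.
have := max_card (mem (map code f)).
rewrite (card_uniqP u) size_map card_tuple card_option card_prod card_bool card_ord.
by rewrite mulnC.
Qed.

(** The width is fixed and an overflow is lost, whence the bounds assumed for the values below. *)
Fixpoint incr (bs : seq bool) : seq bool :=
  if bs is b :: r then if b then false :: incr r else true :: r else [::].

Fixpoint add_pow2 (k : nat) (bs : seq bool) : seq bool :=
  if k is k'.+1 then if bs is b :: r then b :: add_pow2 k' r else [::] else incr bs.

Lemma size_incr bs : size (incr bs) = size bs.
Proof. by elim: bs => //= -[] bs //= ->. Qed.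

Lemma size_add_pow2 k bs : size (add_pow2 k bs) = size bs.
Proof. by elim: k bs => [|k IH] [|b bs] //=; rewrite ?IH // -[RHS](size_incr (b :: bs)). Qed.

Lemma incr_value bs :
  bits_value bs + 1 < 2 ^ size bs -> bits_value (incr bs) = bits_value bs + 1.
Proof.
elim: bs => //= -[] bs IH; rewrite expnS /= => h; last by lia.
by rewrite IH; lia.
Qed.

Lemma add_pow2_value k bs :
  bits_value bs + 2 ^ k < 2 ^ size bs -> bits_value (add_pow2 k bs) = bits_value bs + 2 ^ k.
Proof.
elim: k bs => [|k IH] bs /=; first exact: incr_value.
case: bs => [|b bs] /=; first by case: (2 ^ _).
by rewrite !expnS => h; rewrite IH; lia.
Qed.

(* [b0 :: b1 :: ...] stands for the binary expansion b0.b1b2... *)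
Fixpoint lexi_gt (rs w : seq bool) : bool :=
  if rs is r :: rs' then
    if w is b :: w' then if r == b then lexi_gt rs' w' else b else false
  else has id w.

Section Threshold.
Variable R : realType.
Implicit Types (rho x : R) (rs w bs : seq bool) (ds : seq nat).
Local Open Scope ring_scope.

Lemma pow2_neq0 k : 2 ^+ k != 0 :> R.
Proof. by rewrite expf_eq0 pnatr_eq0 andbF. Qed.

Fixpoint expansion w : R := if w is b :: w' then b%:R + expansion w' / 2 else 0.

Lemma expansion_ge0 w : 0 <= expansion w.
Proof. by elim: w => //= b w IH; rewrite addr_ge0 // divr_ge0. Qed.

Lemma expansion_lt2 w : expansion w < 2.
Proof. by elim: w => [|[] w IH] /=; lra. Qed.

(** Finite words have an [expansion] strictly below 2, so a tail contributes less than 1 and the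
    first differing digit decides. *)
Lemma lexi_gtP rs w : lexi_gt rs w = (expansion rs < expansion w).
Proof.
elim: rs w => [|r rs IH] w /=.
  elim: w => [|[] w IH] /=; first by rewrite ltxx.
    by apply/esym; have := expansion_ge0 w; lra.
  by rewrite IH add0r; apply/idP/idP; lra.
case: w => [|b w] /=.
  by apply/esym/negbTE; rewrite -leNgt; have := expansion_ge0 rs; case: r => /=; lra.
have [] := (expansion_lt2 rs, expansion_lt2 w); have [] := (expansion_ge0 rs, expansion_ge0 w).
case: r b => [] [] /= ? ? ? ?; rewrite ?IH; apply/idP/idP; lra.
Qed.

Lemma expansion_rev bs : expansion (rev bs) * 2 ^+ size bs = 2 * (bits_value bs)%:R.
Proof.
have rc w b : expansion (rcons w b) = expansion w + b%:R / 2 ^+ size w.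
  elim: w => [|c w IH] /=; first by rewrite expr0; field.
  rewrite IH exprS; field; exact: pow2_neq0.
elim: bs => [|b bs IH] /=; first by rewrite mul0r mulr0.
have n0 := pow2_neq0 (size bs).
rewrite rev_cons rc size_rev exprS -muln2 natrD natrM mulrDl mulrCA IH.
by field.
Qed.

(** The digit 1 is taken only if [1 < x], which keeps the truncation strictly below [x]; every
    further digit halves the error. *)
Lemma expansion_below x L : 0 < x -> x <= 2 ->
  exists2 rs, expansion rs < x & x <= expansion rs + 2 / 2 ^+ L.
Proof.
elim: L x => [|L IH] x x0 x2; first by exists [::]; rewrite //= expr0; lra.
have n0 := pow2_neq0 L.
have e : 2 / 2 ^+ L.+1 = (2 / 2 ^+ L) / 2 :> R by rewrite exprS; field.
have [x1|x1] := lerP x 1.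
  by have [||rs h1 h2] := IH (2 * x); [lra..|exists (false :: rs); rewrite /= ?e; lra].
by have [||rs h1 h2] := IH (2 * (x - 1)); [lra..|exists (true :: rs); rewrite /= ?e; lra].
Qed.

Definition dyadic_sum ds : R := \sum_(d <- ds) 2 ^- d.

(* Only finitely many values are possible for a summand that is not tiny, and the others
   sum up to less than [rho / 2]. *)
Lemma dyadic_gap N rho : exists2 delta : R, 0 < delta &
  forall ds, (size ds <= N)%N -> dyadic_sum ds < rho -> dyadic_sum ds <= rho - delta.
Proof.
have p0 d : 0 < 2 ^- d :> R by rewrite invr_gt0 exprn_gt0.
have s0 ds : 0 <= dyadic_sum ds by apply: sumr_ge0 => d _; exact: ltW.
elim: N rho => [|N IH] rho.
  have [r0|r0] := lerP rho 0; first by exists 1 => // ds _; have := s0 ds; lra.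
  exists rho => // ds; rewrite leqn0 size_eq0 => /eqP -> _.
  by rewrite /dyadic_sum big_nil; lra.
have [r0|r0] := lerP rho 0; first by exists 1 => // ds _; have := s0 ds; lra.
(* Summands with exponents from [D] on contribute at most [rho / 2] altogether. *)
have [D hD] : exists D, N.+1%:R * 2 ^- D <= rho / 2.
  exists (Num.bound (N.+1%:R * 2 / rho)).
  have hb : N.+1%:R * 2 / rho < (Num.bound (N.+1%:R * 2 / rho))%:R.
    by apply: archi_boundP; rewrite ?divr_ge0 ?mulr_ge0 // ltW.
  set b := Num.bound _ in hb *.
  have hp : b%:R <= 2 ^+ b :> R by rewrite -natrX ler_nat ltnW // ltn_expl.
  rewrite ler_pdivrMr ?exprn_gt0 //.
  have := lt_le_trans hb hp; rewrite ltr_pdivrMr // => h.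
  lra.
(* Taking out a summand [2^-d] leaves [N] summands to compare with [rho - 2^-d]; [e] is a common gap
   for the finitely many [d < D]. *)
have [e e0 he] : exists2 e : R, 0 < e & forall d ds, (d < D)%N -> (size ds <= N)%N ->
    dyadic_sum ds < rho - 2 ^- d -> dyadic_sum ds <= rho - 2 ^- d - e.
  elim: D {hD} => [|D [e e0 he]]; first by exists 1.
  have [e' e'0 he'] := IH (rho - 2 ^- D).
  exists (Num.min e e'); first by rewrite lt_min e0.
  move=> d ds; rewrite ltnS leq_eqVlt => /orP[/eqP ->|dD] sz h.
    by apply: le_trans (he' ds sz h) _; rewrite lerB // ge_min lexx orbT.
  by apply: le_trans (he d ds dD sz h) _; rewrite lerB // ge_min lexx.
exists (Num.min e (rho / 2)); first by rewrite lt_min e0 divr_gt0.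
move=> ds sz h; have [/hasP[d dd dD]|/hasPn big] := boolP (has (fun d => d < D)%N ds).
  move: h; rewrite /dyadic_sum (big_rem d) //= -/(dyadic_sum _) => h.
  have : dyadic_sum (rem d ds) <= rho - 2 ^- d - e.
    by apply: he => //; [rewrite size_rem //; case: ds dd sz {h} | lra].
  have : Num.min e (rho / 2) <= e by rewrite ge_min lexx.
  lra.
have : dyadic_sum ds <= N.+1%:R * 2 ^- D.
  apply: (@le_trans _ _ (\sum_(d <- ds) 2 ^- D)).
    rewrite /dyadic_sum big_seq [leRHS]big_seq; apply: ler_sum => d /big; rewrite -leqNgt => Dd.
    by rewrite lef_pV2 ?posrE ?exprn_gt0 // ler_eXn2l // ltr1n.
  rewrite big_const_seq count_predT iter_addr_0 -(mulr_natl (2 ^- D)) ler_wpM2r ?ler_nat //.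
  exact: ltW.
have : Num.min e (rho / 2) <= rho / 2 by rewrite ge_min lexx orbT.
lra.
Qed.

(** After division by [2^n], the values avoid an interval of length [e] just below [rho], for all
    [n] at once. The truncation [rs] lies in it, so exceeding [rs] means reaching [rho]. *)
Lemma threshold N rho : 0 < rho -> rho <= 2 -> exists rs,
  forall n ds bs, (size ds <= N)%N -> all (fun d => d <= n)%N ds -> size bs = n.+1 ->
    bits_value bs = (\sum_(d <- ds) 2 ^ d)%N ->
  lexi_gt rs (rev bs) = (rho * 2 ^+ n <= (bits_value bs)%:R).
Proof.
move=> r0 r2; have [e e0 he] := dyadic_gap N rho.
have [L hL] : exists L, 2 / 2 ^+ L < e.
  exists (Num.bound (2 / e)).
  have hb : 2 / e < (Num.bound (2 / e))%:R.
    by apply: archi_boundP; rewrite ?divr_ge0 ?mulr_ge0 // ltW.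
  set b := Num.bound _ in hb *.
  have hp : b%:R <= 2 ^+ b :> R by rewrite -natrX ler_nat ltnW // ltn_expl.
  rewrite ltr_pdivrMr ?exprn_gt0 //.
  by have := lt_le_trans hb hp; rewrite ltr_pdivrMr // mulrC.
have [rs h1 h2] := expansion_below L r0 r2.
exists rs => n ds bs sz dn sb vb; rewrite lexi_gtP.
have n0 : 0 < 2 ^+ n :> R by exact: exprn_gt0.
have E : expansion (rev bs) = (bits_value bs)%:R / 2 ^+ n.
  apply: (@mulIf _ (2 ^+ size bs)); first exact: pow2_neq0.
  by rewrite expansion_rev sb exprS; field; exact: lt0r_neq0.
have S : expansion (rev bs) = dyadic_sum [seq (n - d)%N | d <- ds].
  rewrite E vb natr_sum mulr_suml /dyadic_sum big_map big_seq [RHS]big_seq.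
  apply: eq_bigr => d /(allP dn) /= le; rewrite natrX -{1}(subnK le) exprD.
  by field; rewrite !pow2_neq0.
rewrite -ler_pdivlMr // -E; apply/idP/idP => [h|]; last exact: lt_le_trans.
rewrite leNgt; apply/negP => hlt; move: h; rewrite S in hlt *.
have := he _ _ hlt; rewrite size_map => /(_ sz); lra.
Qed.

End Threshold.

(** * The program *)

Definition evals (P : program) s e v T := exists2 t, t <= T & eval P s e v t.

Section Evaluation.
Variable P : program.
Implicit Types (s : seq tree) (e : expr) (u v : tree) (T : nat).

Lemma evals_leq s e v T T' : evals P s e v T -> T <= T' -> evals P s e v T'.
Proof. by case=> t tT h TT; exists t; first exact: leq_trans tT TT. Qed.

Lemma ev_var s i : evals P s (Var i) (nth Leaf s i) 1.
Proof. by exists 1 => //; constructor. Qed.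

Lemma ev_nil s : evals P s Nil Leaf 1.
Proof. by exists 1 => //; constructor. Qed.

Lemma ev_cons s e1 e2 v1 v2 T1 T2 :
  evals P s e1 v1 T1 -> evals P s e2 v2 T2 -> evals P s (Cons e1 e2) (Node v1 v2) (T1 + T2).+1.
Proof.
by move=> [t1 h1 E1] [t2 h2 E2]; exists (t1 + t2).+1; [rewrite ltnS leq_add | constructor].
Qed.

Lemma ev_let s e1 e2 v1 v2 T1 T2 :
  evals P s e1 v1 T1 -> evals P (v1 :: s) e2 v2 T2 -> evals P s (Let e1 e2) v2 (T1 + T2).+1.
Proof.
move=> [t1 h1 E1] [t2 h2 E2]; exists (t1 + t2).+1; first by rewrite ltnS leq_add.
exact: EvalLet E1 E2.
Qed.

Lemma ev_case s e e0 e1 u v T1 T2 :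
  evals P s e u T1 ->
  (if u is Node l r then evals P [:: l, r & s] e1 v T2 else evals P s e0 v T2) ->
  evals P s (Case e e0 e1) v (T1 + T2).+1.
Proof.
case: u => [|l r] [t1 h1 E1] [t2 h2 E2]; exists (t1 + t2).+1; rewrite ?ltnS ?leq_add //.
  exact: EvalCaseLeaf E1 E2.
exact: EvalCaseNode E1 E2.
Qed.

Definition calls f u v T := evals P [:: u] (nth Nil P f) v T.

Lemma ev_call s f e u v T1 T2 :
  evals P s e u T1 -> calls f u v T2 -> evals P s (Call f e) v (T1 + T2).+1.
Proof.
move=> [t1 h1 E1] [t2 h2 E2]; exists (t1 + t2).+1; first by rewrite ltnS leq_add.
exact: EvalCall E1 E2.
Qed.

End Evaluation.

Definition etrue : expr := Cons Nil Nil.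

Definition solve_args pend b F k acc : expr := Cons pend (Cons b (Cons F (Cons k acc))).

Lemma enc_nil (T : Type) (enc : T -> tree) : enc_seq enc [::] = Leaf.
Proof. by []. Qed.

Lemma enc_cons (T : Type) (enc : T -> tree) x s :
  enc_seq enc (x :: s) = Node (enc x) (enc_seq enc s).
Proof. by []. Qed.

Lemma enc_nat0 : enc_nat 0 = Leaf.
Proof. by []. Qed.

Lemma enc_natS k : enc_nat k.+1 = Node Leaf (enc_nat k).
Proof. by []. Qed.

Definition enat (k : nat) : expr := iter k (Cons Nil) Nil.

Lemma ev_enat P s k : evals P s (enat k) (enc_nat k) (2 * k).+1.
Proof.
elim: k => [|k IH]; first exact: ev_nil.
by apply: evals_leq (ev_cons (ev_nil _ _) IH) _; lia.
Qed.

(** Symbolic execution: the evaluation rules are applied along the expression and calls are resolved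
    by specifications among the hypotheses, so that [ev_start] leaves only a comparison of time
    bounds. *)
Ltac ev_red := lazy beta iota zeta delta [nth enc_bool negb etrue solve_args].
Ltac ev_call_spec := eassumption.
Ltac ev_run :=
  lazymatch goal with
  | |- evals _ _ (Var _) _ _ => apply: ev_var
  | |- evals _ _ Nil _ _ => apply: ev_nil
  | |- evals _ _ (enat _) _ _ => apply: ev_enat
  | |- evals _ _ (Cons _ _) _ _ => eapply ev_cons; [ev_run | ev_run]
  | |- evals _ _ (Let _ _) _ _ => eapply ev_let; [ev_run | ev_red; ev_run]
  | |- evals _ _ (Case _ _ _) _ _ => eapply ev_case; [ev_run | ev_red; ev_run]
  | |- evals _ _ (Call _ _) _ _ => eapply ev_call; [ev_run | ev_red; ev_call_spec]
  end.
Ltac ev_start := rewrite ?(enc_nil, enc_cons, enc_nat0, enc_natS);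
  eapply evals_leq; [ev_red; ev_run |].

(** The numbers in calls are positions in [base]; two arguments are passed as one [Node]. *)
Definition eq_body : expr :=
  Case (Var 0) Nil
    (Case (Var 0) (Case (Var 1) etrue Nil)
      (Case (Var 3) Nil
        (Case (Call 1 (Cons (Var 2) (Var 0))) Nil (Call 1 (Cons (Var 5) (Var 3)))))).

Definition neg_body : expr :=
  Case (Var 0) Nil (Cons (Var 0) (Case (Var 1) etrue Nil)).

Definition mem_body : expr :=
  Case (Var 0) Nil (Case (Var 1) Nil
    (Case (Call 1 (Cons (Var 2) (Var 0))) (Call 3 (Cons (Var 2) (Var 1))) etrue)).

Definition rem_body : expr :=
  Case (Var 0) Nil (Case (Var 1) Nil
    (Case (Call 1 (Cons (Var 2) (Var 0)))
      (Cons (Var 0) (Call 4 (Cons (Var 2) (Var 1)))) (Call 4 (Cons (Var 4) (Var 3))))).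

Definition assign_body : expr :=
  Case (Var 0) Nil (Case (Var 1) Nil
    (Case (Call 3 (Cons (Var 2) (Var 0)))
      (Cons (Call 4 (Cons (Call 2 (Var 2)) (Var 0))) (Call 5 (Cons (Var 2) (Var 1))))
      (Call 5 (Cons (Var 4) (Var 3))))).

Definition dedup_body : expr :=
  Case (Var 0) Nil (Cons (Var 0) (Call 4 (Cons (Var 0) (Call 6 (Var 1))))).

Definition tautology_body : expr :=
  Case (Var 0) Nil
    (Case (Call 3 (Cons (Call 2 (Var 0)) (Var 1))) (Call 7 (Var 1)) etrue).

Definition normalize_body : expr :=
  Case (Var 0) Nil
    (Case (Call 7 (Var 0)) (Cons (Call 6 (Var 0)) (Call 8 (Var 1))) (Call 8 (Var 3))).

Definition pick3_body : expr :=
  Case (Var 0) Nil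
    (Case (Var 0) (Call 9 (Var 1))
      (Case (Var 1) (Call 9 (Var 3))
        (Case (Var 1) (Call 9 (Var 5)) (Var 6)))).

Definition pick2_body : expr :=
  Case (Var 0) Nil
    (Case (Var 0) (Call 10 (Var 1))
      (Case (Var 1) (Call 10 (Var 3)) (Var 4))).

Definition incr_body : expr :=
  Case (Var 0) Nil
    (Case (Var 0) (Cons etrue (Var 1)) (Cons Nil (Call 11 (Var 3)))).

Definition add_pow2_body : expr :=
  Case (Var 0) Nil
    (Case (Var 0) (Call 11 (Var 1))
      (Case (Var 3) Nil (Cons (Var 0) (Call 12 (Cons (Var 3) (Var 1)))))).

Definition catrev_body : expr :=
  Case (Var 0) Nil
    (Case (Var 0) (Var 1) (Call 13 (Cons (Var 1) (Cons (Var 0) (Var 3))))).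

(* Once the argument is taken apart, the variables 6, 4, 2, 0 and 1 are the pending literals,
   the budget, the formula, the number of unassigned variables and the accumulator. *)
Definition solve_body : expr :=
  Case (Var 0) Nil (Case (Var 1) Nil (Case (Var 1) Nil (Case (Var 1) Nil
    (Case (Var 6)
      (Let (Call 9 (Var 2))
        (Case (Var 0)
          (Let (Call 10 (Var 3))
            (Case (Var 0)
              (Case (Var 4)
                (Cons Nil (Call 12 (Cons (Var 2) (Var 3))))
                (Case (Var 0)
                  (Cons Nil (Var 5))
                  (Case (Var 6) Nil
                    (Call 14 (solve_args Nil (Var 12) (Call 5 (Cons (Var 2) (Var 10)))
                                         (Var 1) (Var 9))))))
              (Case (Var 8) Nil
                (Call 14 (solve_args (Var 4) (Var 1) (Var 8) (Var 6) (Var 7))))))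
          (Case (Var 7) Nil
            (Call 14 (solve_args (Var 4) (Var 1) (Var 7) (Var 5) (Var 6))))))
      (Case (Var 2) Nil
        (Case (Call 14 (solve_args (Var 3) (Var 8) (Call 5 (Cons (Var 2) (Var 6)))
                                   (Var 1) (Var 5)))
          Nil
          (Call 14 (solve_args (Var 5) (Var 10) (Call 5 (Cons (Call 2 (Var 4)) (Var 8)))
                               (Var 3) (Var 1))))))))).

(** The initial accumulator [Cons Nil (Var 0)] is [n + 1] in unary, which as a tree is also a list
    of [n + 1] zero bits. The sum is reversed because the comparison starts from the most
    significant bit. *)
Definition main_body (B : nat) : expr :=
  Case (Var 0) Nil
    (Let (Call 14 (solve_args Nil (enat B) (Call 8 (Var 1)) (Var 0) (Cons Nil (Var 0))))
      (Case (Var 0) Nil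
        (Case (Call 15 (Call 13 (Cons (Var 1) Nil))) Nil (Cons Nil (Var 3))))).

Definition base (B : nat) : program :=
  [:: main_body B; eq_body; neg_body; mem_body; rem_body; assign_body; dedup_body;
      tautology_body; normalize_body; pick3_body; pick2_body; incr_body; add_pow2_body;
      catrev_body; solve_body].

(* The bits of the threshold are spread over a chain of functions, so that reading the first
   ones takes a time independent of their total number. *)
Fixpoint lexi_gt_bodies (j : nat) (rs : seq bool) : program :=
  if rs is r :: rs' then
    (if r then Case (Var 0) Nil (Case (Var 0) Nil (Call j.+1 (Var 3)))
     else Case (Var 0) Nil (Case (Var 0) (Call j.+1 (Var 1)) etrue))
    :: lexi_gt_bodies j.+1 rs'
  else [:: Case (Var 0) Nil (Case (Var 0) (Call j (Var 1)) etrue)].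

Definition the_program B rs : program := base B ++ lexi_gt_bodies 15 rs.

Lemma enc_nat_inj : injective enc_nat.
Proof. by elim=> [|i IH] [|j] // -[/IH ->]. Qed.

Fixpoint tree_size (t : tree) : nat :=
  if t is Node l r then (tree_size l + tree_size r).+1 else 1.

Fixpoint tree_eq (t u : tree) : bool :=
  match t, u with
  | Leaf, Leaf => true
  | Node a b, Node c d => tree_eq a c && tree_eq b d
  | _, _ => false
  end.

Lemma tree_eqP t u : reflect (t = u) (tree_eq t u).
Proof.
elim: t u => [|a IHa b IHb] [|c d] /=; try by constructor.
apply: (iffP andP) => [[/IHa -> /IHb ->]//|[<- <-]].
by split; [apply/IHa | apply/IHb].
Qed.

(** Each bit read passes to the next function of the chain, which lengthens [pre]; the last function
    calls itself. *)
Lemma lexi_gt_calls P pre rs (w : seq bool) : P = pre ++ lexi_gt_bodies (size pre) rs ->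
  calls P (size pre) (enc_seq enc_bool w) (enc_bool (lexi_gt rs w)) (10 * (size w).+1).
Proof.
elim: w pre rs => [|b w IH] pre [|r rs] eP;
  rewrite /calls eP nth_cat ltnn subnn ?nth0 /= -eP ?enc_cons.
- by ev_start.
- by case: r {eP}; ev_start.
- have := IH pre [::] eP; case: b => h; ev_start; lia.
have := IH (rcons pre (if r then Case (Var 0) Nil (Case (Var 0) Nil (Call (size pre).+1 (Var 3)))
     else Case (Var 0) Nil (Case (Var 0) (Call (size pre).+1 (Var 1)) etrue))) rs.
rewrite size_rcons cat_rcons => /(_ eP) h.
by case: r b h {eP} => [] [] h /=; ev_start; lia.
Qed.


(** * Specifications and running times of the auxiliary functions *)

Section Functions.
Variables (B : nat) (rs : seq bool) (n : nat).
Local Notation P := (the_program B rs).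
Local Notation lit := (@enc_literal n).
Local Notation cl := (enc_seq (@enc_literal n)).
Local Notation fm := (enc_seq (enc_seq (@enc_literal n))).
Local Notation bits := (enc_seq enc_bool).
Local Notation W := (40 * n + 80).
Implicit Types (l k : literal n) (c : clause n) (F : cnf n).

Lemma tree_eq_calls t u : calls P 1 (Node t u) (enc_bool (tree_eq t u)) (20 * tree_size t).
Proof.
elim: t u => [|a IHa b IHb] u; rewrite /calls -[nth Nil P _]/eq_body /eq_body.
  by case: u => [|c d]; ev_start.
case: u => [|c d] /=; first by ev_start; lia.
have := IHa c; have := IHb d; case: (tree_eq a c) => h1 h2; ev_start; lia.
Qed.

Lemma eq_calls l k : calls P 1 (Node (lit l) (lit k)) (enc_bool (l == k)) W.
Proof.
have := tree_eq_calls (lit l) (lit k).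
have -> : tree_eq (lit l) (lit k) = (l == k).
  apply/tree_eqP/eqP => [|-> //]; case: l k => x b [y c] [] h1 h2.
  have -> : b = c by case: b c h2 => [] [].
  by congr (_, _); apply/val_inj/enc_nat_inj.
move=> h; apply: evals_leq h _.
have sn i : tree_size (enc_nat i) = (2 * i).+1 by elim: i => //= i ->; lia.
by case: l => x b; rewrite /= sn; have := ltn_ord x; case: b => /=; lia.
Qed.

Lemma neg_calls l : calls P 2 (lit l) (lit (neg l)) 10.
Proof.
rewrite /calls -[nth Nil P _]/neg_body /neg_body; case: l => x b.
by rewrite /neg /enc_literal /=; case: b; ev_start.
Qed.

Lemma mem_calls l c : calls P 3 (Node (lit l) (cl c)) (enc_bool (l \in c)) ((W + 20) * (size c).+1).
Proof.
elim: c => [|k c IH]; rewrite /calls -[nth Nil P _]/mem_body /mem_body.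
  by ev_start; lia.
rewrite enc_cons inE; have := eq_calls l k; case: (l == k) => h; ev_start; rewrite /=; nia.
Qed.

Lemma rem_calls l c : calls P 4 (Node (lit l) (cl c))
  (cl [seq k <- c | k != l]) ((W + 20) * (size c).+1).
Proof.
elim: c => [|k c IH]; rewrite /calls -[nth Nil P _]/rem_body /rem_body.
  by ev_start; lia.
rewrite enc_cons /= eq_sym; have := eq_calls l k.
by case: (l == k) => h; rewrite ?enc_cons; ev_start; rewrite /=; nia.
Qed.

Lemma assign_calls l F : all (fun c => size c <= 3) F ->
  calls P 5 (Node (lit l) (fm F)) (fm (assign l F)) ((8 * W + 250) * (size F).+1).
Proof.
elim: F => [|c F IH]; rewrite /calls -[nth Nil P _]/assign_body /assign_body.
  by move=> _; ev_start; lia.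
case/andP => sc /IH {}IH; rewrite enc_cons /assign /= -/(assign l F).
have m := mem_calls l c; have r := rem_calls (neg l) c; have h := neg_calls l.
have ml : (W + 20) * (size c).+1 <= (W + 20) * 4 by rewrite leq_mul2l ltnS sc orbT.
case: (l \in c) m => m; rewrite /= ?enc_cons; ev_start; rewrite /=; nia.
Qed.

Lemma dedup_calls c : size c <= 3 -> calls P 6 (cl c) (cl (dedup c)) ((4 * W + 100) * (size c).+1).
Proof.
elim: c => [|l c IH] sc; rewrite /calls -[nth Nil P _]/dedup_body /dedup_body.
  by ev_start; lia.
have {}IH := IH (ltnW sc); rewrite [dedup _]/=.
have r := rem_calls l (dedup c).
have ml : (W + 20) * (size (dedup c)).+1 <= (W + 20) * 4.
  by rewrite leq_mul2l ltnS (leq_trans (size_dedup c)) ?orbT // ltnW.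
ev_start; rewrite /=; nia.
Qed.

Lemma tautology_calls c : size c <= 3 ->
  calls P 7 (cl c) (enc_bool (tautology c)) ((4 * W + 130) * (size c).+1).
Proof.
elim: c => [|l c IH] sc; rewrite /calls -[nth Nil P _]/tautology_body /tautology_body.
  by ev_start; lia.
have {}IH := IH (ltnW sc); rewrite [tautology _]/=.
have m := mem_calls (neg l) c; have h := neg_calls l.
have ml : (W + 20) * (size c).+1 <= (W + 20) * 4 by rewrite leq_mul2l ltnS ltnW ?orbT.
case: (neg l \in c) m => m; ev_start; rewrite /=; nia.
Qed.

Lemma normalize_calls F : all (fun c => size c <= 3) F ->
  calls P 8 (fm F) (fm (normalize F)) ((32 * W + 1000) * (size F).+1).
Proof.
elim: F => [|c F IH]; rewrite /calls -[nth Nil P _]/normalize_body /normalize_body.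
  by move=> _; ev_start; lia.
case/andP => sc /IH {}IH; rewrite enc_cons /normalize /= -/(normalize F).
have t := tautology_calls sc; have d := dedup_calls sc.
have h1 : (4 * W + 130) * (size c).+1 <= (4 * W + 130) * 4 by rewrite leq_mul2l ltnS sc orbT.
have h2 : (4 * W + 100) * (size c).+1 <= (4 * W + 100) * 4 by rewrite leq_mul2l ltnS sc orbT.
case: (tautology c) t => t; rewrite /= ?enc_cons; ev_start; rewrite /=; nia.
Qed.

(* The empty clause, encoded as [Leaf], stands for the absence of a clause. *)
Definition select w F : clause n := head [::] [seq c <- F | w <= size c].

Lemma select3_calls F : calls P 9 (fm F) (cl (select 3 F)) (15 * (size F).+1).
Proof.
elim: F => [|c F IH]; rewrite /calls -[nth Nil P _]/pick3_body /pick3_body.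
  by ev_start; lia.
rewrite /select in IH *; case: c => [|l [|l' [|l'' c]]];
  rewrite [head _ _]/=; ev_start; rewrite /=; lia.
Qed.

Lemma select2_calls F : calls P 10 (fm F) (cl (select 2 F)) (15 * (size F).+1).
Proof.
elim: F => [|c F IH]; rewrite /calls -[nth Nil P _]/pick2_body /pick2_body.
  by ev_start; lia.
rewrite /select in IH *; case: c => [|l [|l' c]]; rewrite [head _ _]/=; ev_start; rewrite /=; lia.
Qed.

Lemma incr_calls bs : calls P 11 (bits bs) (bits (incr bs)) (12 * (size bs).+1).
Proof.
elim: bs => [|b bs IH]; rewrite /calls -[nth Nil P _]/incr_body /incr_body.
  by ev_start.
by case: b; rewrite [incr _]/=; ev_start; rewrite /=; lia.
Qed.

Lemma add_pow2_calls (d : nat) (bs : seq bool) :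
  calls P 12 (Node (enc_nat d) (bits bs)) (bits (add_pow2 d bs)) (20 * (size bs).+1).
Proof.
elim: d bs => [|d IH] bs; rewrite /calls -[nth Nil P _]/add_pow2_body /add_pow2_body.
  have := incr_calls bs; rewrite [enc_nat 0]/= => h; ev_start; lia.
rewrite enc_natS; case: bs => [|b bs]; first by ev_start.
have := IH bs; rewrite [add_pow2 _ _]/= => h; ev_start; rewrite /=; lia.
Qed.

Lemma catrev_calls bs bs' : calls P 13 (Node (bits bs) (bits bs')) (bits (catrev bs bs'))
  (15 * (size bs).+1).
Proof.
elim: bs bs' => [|b bs IH] bs'; rewrite /calls -[nth Nil P _]/catrev_body /catrev_body.
  by ev_start; lia.
rewrite [catrev _ _]/=; have := IH (b :: bs'); rewrite enc_cons => h; ev_start; rewrite /=; lia.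
Qed.

Lemma lexi_calls w : calls P 15 (bits w) (enc_bool (lexi_gt rs w)) (10 * (size w).+1).
Proof. exact: (@lexi_gt_calls _ (base B)). Qed.

End Functions.

(** * Correctness and running time of the search *)

Section Solve.
Variables (B : nat) (rs : seq bool) (n : nat) (F : cnf n).
Hypothesis normF : all (@normal n) F.
Local Notation P := (the_program B rs).
Local Notation lit := (@enc_literal n).
Local Notation cl := (enc_seq (@enc_literal n)).
Local Notation fm := (enc_seq (enc_seq (@enc_literal n))).
Local Notation bits := (enc_seq enc_bool).
Local Notation W := (40 * n + 80).
Implicit Types (l k : literal n) (c p pend : clause n).

Lemma select_all w (G : cnf n) : 0 < w -> select w G = [::] -> all (fun c => size c < w) G.
Proof.
move=> w0; rewrite /select; elim: G => //= c G IH.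
have [wc|cw] := leqP w (size c) => /= e; last exact: IH.
by move: wc; rewrite e leqNgt w0.
Qed.

Lemma select_mem w (G : cnf n) l c : select w G = l :: c ->
  (l :: c \in G) && (w <= size (l :: c)).
Proof.
rewrite /select; elim: G => //= d G IH; case: leqP => //= wd; last first.
  by move=> /IH /andP[h1 h2]; rewrite inE h1 orbT.
by move=> e; rewrite e in wd *; rewrite mem_head.
Qed.

Definition add_all (ds : seq nat) (acc : seq bool) := foldl (fun bs d => add_pow2 d bs) acc ds.

Lemma size_add_all ds acc : size (add_all ds acc) = size acc.
Proof. by elim: ds acc => //= d ds IH acc; rewrite IH size_add_pow2. Qed.

Lemma add_all_value ds acc :
    bits_value acc + \sum_(d <- ds) 2 ^ d < 2 ^ size acc ->
  bits_value (add_all ds acc) = bits_value acc + \sum_(d <- ds) 2 ^ d.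
Proof.
elim: ds acc => [|d ds IH] acc; first by rewrite big_nil addn0.
rewrite big_cons => h /=; have e : bits_value (add_pow2 d acc) = bits_value acc + 2 ^ d.
  by apply: add_pow2_value; apply: leq_ltn_trans h; rewrite leq_add2l leq_addr.
by rewrite IH e -addnA // size_add_pow2.
Qed.

Let A := (8 * W + 250) * (size F).+1.
Let Q := 15 * (size F).+1.
Definition step_time := (20 * W + 1000) * (size F).+1.

Lemma size_residual p : size (residual F p) <= size F.
Proof. by rewrite size_map size_filter count_size. Qed.

Lemma residual_calls p l : neg l \notin p ->
  calls P 5 (Node (lit l) (fm (residual F p))) (fm (residual F (l :: p))) A.
Proof.
move=> nl; rewrite -assign_residual //; apply: evals_leq (assign_calls _ _ _ _) _.
  by have := residual_size p (residual_size3 normF); rewrite cats0.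
by rewrite leq_mul2l ltnS size_residual orbT.
Qed.

Lemma pick3_residual_calls p : calls P 9 (fm (residual F p)) (cl (select 3 (residual F p))) Q.
Proof. by apply: evals_leq (select3_calls _ _ _) _; rewrite leq_mul2l ltnS size_residual. Qed.

Lemma pick2_residual_calls p : calls P 10 (fm (residual F p)) (cl (select 2 (residual F p))) Q.
Proof. by apply: evals_leq (select2_calls _ _ _) _; rewrite leq_mul2l ltnS size_residual. Qed.

Lemma step_timeE : 2 * A + 2 * Q + 20 * n + 300 <= step_time.
Proof. rewrite /A /Q /step_time; nia. Qed.

(** A potential for [s] pending literals, budget [b] and [k] unassigned variables: a pending literal
    doubles it, the factor 16 pays for the at most three literals of a chosen clause, and [k.+1]
    pays for unit steps. The subtracted 1 leaves room for the current step. *)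
Definition search_time (s b k : nat) := (2 ^ s.+1 * 16 ^ b * k.+1).-1 * step_time.

Lemma search_time_branch (s b k : nat) :
  2 * search_time s b k + step_time <= search_time s.+1 b k.+1.
Proof.
rewrite /search_time mulnA -mulSnr leq_mul2r; apply/orP; right.
have h : 0 < 2 ^ s.+1 * 16 ^ b * k.+1 by rewrite !muln_gt0 !expn_gt0.
suff : 2 * (2 ^ s.+1 * 16 ^ b * k.+1) <= 2 ^ s.+2 * 16 ^ b * k.+2 by lia.
by rewrite !mulnA -expnS leq_mul2l leqnSn orbT.
Qed.

Lemma search_time_pick (s b k : nat) : s <= 3 ->
  search_time s b k + step_time <= search_time 0 b.+1 k.
Proof.
move=> s3; rewrite /search_time -mulSnr leq_mul2r; apply/orP; right.
have h : 0 < 2 ^ s.+1 * 16 ^ b * k.+1 by rewrite !muln_gt0 !expn_gt0.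
have h0 : 0 < 16 ^ b * k.+1 by rewrite !muln_gt0 !expn_gt0.
have : 2 ^ s.+1 <= 16 by rewrite (@leq_trans (2 ^ 4)) // leq_pexp2l.
have -> : 2 ^ 1 * 16 ^ b.+1 * k.+1 = 32 * (16 ^ b * k.+1) by rewrite (expnS 16) expn1; ring.
move: h h0; rewrite -mulnA; move: (2 ^ s.+1) (16 ^ b * k.+1) => x y h h0 h2.
by have := leq_mul h2 (leqnn y); lia.
Qed.

Lemma search_time_unit (b k : nat) : search_time 0 b k + step_time <= search_time 0 b k.+1.
Proof.
rewrite /search_time -mulSnr leq_mul2r; apply/orP; right.
have : 0 < 16 ^ b by rewrite expn_gt0.
by rewrite expn1; nia.
Qed.

Lemma search_time_ge (s b k : nat) : step_time <= search_time s b k.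
Proof.
rewrite -{1}[step_time]mul1n leq_mul2r; apply/orP; right.
have h : 0 < 16 ^ b by rewrite expn_gt0.
have h0 : 0 < 2 ^ s by rewrite expn_gt0.
rewrite expnS; nia.
Qed.

Definition enc_state pend b p acc : tree :=
  Node (cl pend) (Node (enc_nat b) (Node (fm (residual F p))
    (Node (enc_nat (n - size p)) (bits acc)))).

Definition search_stuck := exists p c,
  [/\ reach F B p [::] 0, c \in residual F p & 1 < size c].

(** Each choice splits into at most [2^3] paths, whence [8^b]. The exponents [ds] come from the
    leaves; contradictory leaves contribute none. *)
Definition search_result pend b p acc out :=
  (out = Leaf /\ search_stuck) \/
  exists ds, [/\ out = Node Leaf (bits (add_all ds acc)),
    size ds <= 2 ^ size pend * 8 ^ b, all (fun d => d <= n) ds &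
    npath F p = \sum_(d <- ds) 2 ^ d].

Lemma path_room p l : uniq (map fst (l :: p)) -> n - size p = (n - size (l :: p)).+1.
Proof.
move=> u; have := max_card (mem (map fst (l :: p))).
by rewrite (card_uniqP u) size_map card_ord => h; rewrite subnS prednK // subn_gt0.
Qed.

Lemma notin_path p l k : l.1 \notin map fst p -> k.1 = l.1 -> k \notin p.
Proof. by move=> h e; apply: contra h => kp; rewrite -e map_f. Qed.

Lemma residual_cat_uniq p c :
  c \in residual F p -> uniq (map fst p) -> uniq (map fst (c ++ p)).
Proof.
move=> cr up; rewrite map_cat cat_uniq (residual_uniq normF cr) up andbT.
apply/hasPn => x xp; apply/mapP => -[l lc e].
by have := residual_vars cr lc; rewrite -e xp.
Qed.

(** Every recursive call lowers [b + (n - size p)]: branching and unit steps assign a variable, a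
    choice spends budget. [reach] is carried along to exhibit the stuck path if the result is
    [Leaf]. *)
Lemma solve_calls p pend b acc :
    reach F B p pend b -> uniq (map fst (pend ++ p)) -> size acc = n.+1 ->
  exists out, calls P 14 (enc_state pend b p acc) out
      (search_time (size pend) b (n - size p)) /\ search_result pend b p acc out.
Proof.
have [N] := ubnP (b + (n - size p)); elim: N p pend b acc => // N IH p pend b acc.
rewrite ltnS => leN rp up sa; have stE := step_timeE.
have hU := search_time_ge (size pend) b (n - size p).
case: pend rp up hU => [|l pend] rp up hU; last first.
  have upl k : k.1 = l.1 -> uniq (map fst (pend ++ k :: p)).
    by move=> e; rewrite map_cat /= e -cat1s uniq_catCA -map_cat.
  have lp : l.1 \notin map fst p by move: up; rewrite /= map_cat mem_cat => /andP[/norP[]].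
  have room k : n - size p = (n - size (k :: p)).+1.
    apply: (@path_room p l); have := upl l erefl.
    by rewrite map_cat cat_uniq => /and3P[].
  have lt k : b + (n - size (k :: p)) < N by move: leN; rewrite (room k); lia.
  have hb := search_time_branch (size pend) b (n - size (l :: p)).
  have a1 : calls P 5 _ _ A := residual_calls (notin_path lp (erefl (neg l).1)).
  have a2 : calls P 5 _ _ A := @residual_calls p (neg l) (notin_path lp (erefl (neg (neg l)).1)).
  (* A [Leaf] from the branch of [l] is returned at once; otherwise its sum becomes the accumulator
     for the branch of [neg l]. *)
  have := IH (l :: p) pend b acc (lt l) (ReachBranch rp (mem_head _ _)) (upl l erefl) sa.
  case=> out [h1 [[e st]|[ds1 [e s1 n1 c1]]]].
    exists Leaf; split; last by left.
    rewrite /calls -[nth Nil P _]/solve_body /solve_body /enc_state (room l).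
    rewrite e /enc_state in h1.
    ev_start; rewrite [size (l :: pend)]/=; set r := n - size (l :: p) in hb *; lia.
  have neg_in : neg l \in [:: l; neg l] by rewrite !inE eqxx orbT.
  have := IH (neg l :: p) pend b (add_all ds1 acc) (lt (neg l))
    (ReachBranch rp neg_in) (upl (neg l) erefl).
  rewrite size_add_all => /(_ sa) [out' [h2 hres]].
  exists out'; split.
    rewrite /calls -[nth Nil P _]/solve_body /solve_body /enc_state (room l).
    rewrite e /enc_state in h1; rewrite /enc_state in h2.
    have hn := neg_calls B rs l.
    ev_start; rewrite [size (l :: pend)]/=; set r := n - size (l :: p) in hb *.
    change (n - size (neg l :: p)) with r; lia.
  case: hres => [[-> st]|[ds2 [-> s2 n2 c2]]]; [by left | right].
  exists (ds1 ++ ds2); split.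
  - by rewrite /add_all foldl_cat.
  - by rewrite size_cat /= expnS -mulnA mul2n -addnn leq_add.
  - by rewrite all_cat n1.
  - by rewrite (npath_split _ _ l) big_cat c1 c2.
have p3 := pick3_residual_calls p; have p2 := pick2_residual_calls p.
(* If there is a clause of size 3, the path is stuck without budget; otherwise the literals of the
   clause become pending. Size 2 is treated likewise afterwards. *)
case E3 : (select 3 (residual F p)) p3 => [|l c] p3; last first.
  rewrite enc_cons in p3.
  have /andP[cr s3] := select_mem E3.
  have {}s3 : size (l :: c) = 3.
    apply/eqP; rewrite eqn_leq s3 andbT.
    by have := allP (residual_size p (residual_size3 normF)) (l :: c); rewrite cats0; apply.
  have uc : uniq (map fst ((l :: c) ++ p)) by exact: residual_cat_uniq.
  case: b leN rp hU => [|b] leN rp hU.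
    exists Leaf; split; last by left; split=> //; exists p, (l :: c); rewrite s3.
    rewrite /calls -[nth Nil P _]/solve_body /solve_body /enc_state.
    ev_start; lia.
  have [out [h res]] := IH p (l :: c) b acc ltac:(lia) (ReachPick3 rp cr s3) uc sa.
  exists out; split.
    rewrite /calls -[nth Nil P _]/solve_body /solve_body /enc_state.
    rewrite /enc_state enc_cons in h.
    have := @search_time_pick (size (l :: c)) b (n - size p) ltac:(by rewrite s3) => ht.
    ev_start; rewrite [size [::]]/=; lia.
  case: res => [[-> st]|[ds [-> sd nd cd]]]; [by left | right].
  by exists ds; split=> //; apply: leq_trans sd _; rewrite s3 expn0 mul1n (expnS 8).
rewrite enc_nil in p3.
have all1 : all (fun c => size c <= 2) (residual F p) by exact: select_all E3.
case E2 : (select 2 (residual F p)) p2 => [|l c] p2; last first.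
  rewrite enc_cons in p2.
  have /andP[cr s2] := select_mem E2.
  have {}s2 : size (l :: c) = 2.
    by apply/eqP; rewrite eqn_leq s2 andbT; apply: (allP all1 _ cr).
  have uc : uniq (map fst ((l :: c) ++ p)) by exact: residual_cat_uniq.
  case: b leN rp hU => [|b] leN rp hU.
    exists Leaf; split; last by left; split=> //; exists p, (l :: c); rewrite s2.
    rewrite /calls -[nth Nil P _]/solve_body /solve_body /enc_state.
    ev_start; lia.
  have [out [h res]] := IH p (l :: c) b acc ltac:(lia) (ReachPick2 rp all1 cr s2) uc sa.
  exists out; split.
    rewrite /calls -[nth Nil P _]/solve_body /solve_body /enc_state.
    rewrite /enc_state enc_cons in h.
    have := @search_time_pick (size (l :: c)) b (n - size p) ltac:(by rewrite s2) => ht.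
    ev_start; rewrite [size [::]]/=; lia.
  case: res => [[-> st]|[ds [-> sd nd cd]]]; [by left | right].
  by exists ds; split=> //; apply: leq_trans sd _; rewrite s2 expn0 mul1n (expnS 8) leq_mul2r orbT.
rewrite enc_nil in p2.
have {}all1 : all (fun c => size c <= 1) (residual F p) by exact: select_all E2.
(* Without clauses all free variables are arbitrary; otherwise the first clause is either empty,
   giving 0, or a unit to be propagated. *)
case E : (residual F p) => [|c G].
  exists (Node Leaf (bits (add_all [:: n - size p] acc))); split.
    rewrite /calls -[nth Nil P _]/solve_body /solve_body /enc_state.
    rewrite E in p3 p2 *; have h := add_pow2_calls B rs (n - size p) acc.
    rewrite sa in h; ev_start; lia.
  right; exists [:: n - size p]; split=> //; first by rewrite muln_gt0 !expn_gt0.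
    by rewrite /= leq_subr.
  by rewrite big_seq1 npath_done.
have cr : c \in residual F p by rewrite E mem_head.
have := allP all1 c cr; case: c E cr => [|l [|//]] E cr _.
  exists (Node Leaf (bits (add_all [::] acc))); split.
    rewrite /calls -[nth Nil P _]/solve_body /solve_body /enc_state.
    rewrite E in p3 p2 *; ev_start; lia.
  by right; exists [::]; split=> //; rewrite big_nil npath_empty_clause.
have ul : uniq (map fst (l :: p)) := residual_cat_uniq cr up.
have lp : l.1 \notin map fst p by case/andP: ul.
have room := path_room ul.
have hb := search_time_unit b (n - size (l :: p)).
have lt : b + (n - size (l :: p)) < N by move: leN; rewrite room; lia.
have a1 : calls P 5 _ _ A := residual_calls (notin_path lp (erefl (neg l).1)).
have [out [h res]] := IH (l :: p) [::] b acc lt (ReachUnit l rp all1) ul sa.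
exists out; split.
  rewrite /calls -[nth Nil P _]/solve_body /solve_body /enc_state room.
  rewrite /enc_state in h; rewrite E in p3 p2 a1 *.
  ev_start; rewrite [size [::]]/= in hb *; set r := n - size (l :: p) in hb *; lia.
case: res => [[-> st]|[ds [-> sd nd cd]]]; [by left | right].
by exists ds; split=> //; rewrite (npath_unit cr).
Qed.

End Solve.

(** * The entry point of the program *)

Lemma enc_zeros k : enc_seq enc_bool (nseq k false) = enc_nat k.
Proof. by elim: k => // k IH; rewrite [nseq _ _]/= enc_cons IH. Qed.

Lemma bits_value_zeros k : bits_value (nseq k false) = 0.
Proof. by elim: k => //= k ->. Qed.

Lemma count_satE n (f : cnf n) : count_sat f = nsat (fun a => sat_cnf a (normalize f)).
Proof. by apply: eq_nsat => a; rewrite sat_normalize. Qed.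

Section Main.
Variables (B : nat) (rs : seq bool) (n : nat) (f : cnf n).
Hypothesis f3 : is_3cnf f.
Local Notation P := (the_program B rs).
Local Notation bits := (enc_seq enc_bool).
Local Notation W := (40 * n + 80).

(** The fifth power consists of one factor [n + 1] from [search_time], one from [W], and a cube from
    the number of clauses. The constant is [8 * 100 * 130], with 8 from [S] and the rest from
    [hW]. *)
Lemma main_time :
  search_time (normalize f) 0 B n + (32 * W + 1000) * (size f).+1 + 2 * B + 30 * n + 300
  <= 16 ^ B * (800 * 130) * n.+1 ^ 5.
Proof.
have sF : size (normalize f) <= size f by rewrite size_map size_filter count_size.
have B16 : B <= 16 ^ B by apply: ltnW; rewrite ltn_expl.
have hst : step_time (normalize f) <= (20 * W + 1000) * (size f).+1.
  by rewrite leq_mul2l ltnS sF orbT.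
have S : (size f).+1 <= 8 * n.+1 ^ 3.
  by have := size_3cnf f3; rewrite !expnS !expn0 !muln1; nia.
have h1 : search_time (normalize f) 0 B n <= 2 * 16 ^ B * n.+1 * ((20 * W + 1000) * (size f).+1).
  by rewrite /search_time expn1; apply: leq_mul hst; apply: leq_pred.
have p16 : 0 < 16 ^ B by rewrite expn_gt0.
set D := 16 ^ B * n.+1 * (size f).+1.
have : D * (100 * W + 5000) <= 16 ^ B * (800 * 130) * n.+1 ^ 5.
  rewrite /D (_ : n.+1 ^ 5 = n.+1 * (n.+1 ^ 3 * n.+1)); last by rewrite !expnS expn0; ring.
  have : 100 * W + 5000 <= 130 * (100 * n.+1) by lia.
  move=> hW; apply: leq_trans (leq_mul (leq_mul (leqnn _) S) hW) _.
  by apply/eq_leq; ring.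
apply: leq_trans.
have hD1 : (size f).+1 <= D by rewrite /D leq_pmull // muln_gt0 p16.
have hD2 : B <= D by rewrite /D; apply: leq_trans B16 _; rewrite -mulnA leq_pmulr // muln_gt0.
have hD3 : n.+1 <= D by rewrite /D; apply: leq_trans (leq_pmulr _ _) => //; apply: leq_pmull.
have h2 : search_time (normalize f) 0 B n <= D * (40 * W + 2000).
  by apply: leq_trans h1 _; apply/eq_leq; rewrite /D; ring.
have h3 : (32 * W + 1000) * (size f).+1 <= D * (32 * W + 1000) by rewrite mulnC leq_mul2r hD1 orbT.
move: h2 h3 hD1 hD2 hD3; move: (search_time _ _ _ _) ((32 * W + 1000) * _) D => x y z.
move: W => w; move=> *; have -> : z * (100 * w + 5000) = 100 * (z * w) + 5000 * z by ring.
have e1 : z * (40 * w + 2000) = 40 * (z * w) + 2000 * z by ring.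
have e2 : z * (32 * w + 1000) = 32 * (z * w) + 1000 * z by ring.
lia.
Qed.

Lemma main_calls : exists out,
  calls P 0 (enc_cnf f) out (16 ^ B * (800 * 130) * n.+1 ^ 5) /\
  ((out = Leaf /\ search_stuck B (normalize f)) \/
   exists ds bs, [/\ size ds <= 8 ^ B, all (fun d => d <= n) ds, size bs = n.+1,
     bits_value bs = \sum_(d <- ds) 2 ^ d & count_sat f = bits_value bs /\
     out = if lexi_gt rs (rev bs) then Node Leaf (bits bs) else Leaf]).
Proof.
have [_ s3] := andP f3; have normF := normalize_normal s3.
have hn := normalize_calls B rs s3.
have hT := main_time.
have szero : size (nseq n.+1 false) = n.+1 by rewrite size_nseq.
have [r [h res]] := @solve_calls B rs _ _ normF _ _ _ _ (ReachInit _ _) isT szero.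
rewrite /enc_state residual_nil enc_nil enc_zeros enc_natS subn0 in h.
case: res => [[er st]|[ds [er sd nd cd]]]; rewrite er in h.
  exists Leaf; split; last by left.
  rewrite /calls -[nth Nil P _]/(main_body B) /main_body /enc_cnf.
  ev_start; rewrite [size [::]]/= in hT *; lia.
set bs := add_all _ _ in h er.
have sbs : size bs = n.+1 by rewrite size_add_all.
have ec : count_sat f = \sum_(d <- ds) 2 ^ d by rewrite -cd count_satE.
have vbs : bits_value bs = \sum_(d <- ds) 2 ^ d.
  (* The count is at most [2^n], so [n + 1] bits do not overflow. *)
  rewrite add_all_value bits_value_zeros // add0n size_nseq -ec.
  have -> : count_sat f = nsat (fun a => sat_cnf a f) by [].
  apply: leq_ltn_trans (_ : 2 ^ n < _); last by rewrite ltn_exp2l.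
  by rewrite -nsatT; apply: leq_nsat.
exists (if lexi_gt rs (rev bs) then Node Leaf (bits bs) else Leaf); split; last first.
  by right; exists ds, bs; rewrite ec -vbs; split=> //; rewrite -[8 ^ B]mul1n.
have hr := catrev_calls B rs bs [::]; rewrite enc_nil -/(rev bs) sbs in hr.
have hl := lexi_calls B rs (rev bs); rewrite size_rev sbs in hl.
rewrite /calls -[nth Nil P _]/(main_body B) /main_body /enc_cnf.
by case: (lexi_gt rs (rev bs)) hl => hl; ev_start; rewrite [size [::]]/= in hT *; lia.
Qed.

End Main.

(** * The budget in terms of [eps] *)

Section Budget.
Variable R : realType.
Implicit Types (eps : R).
Local Open Scope ring_scope.

(** If [m + 1] is the least exponent, then [(4/3)^m <= 1 / eps]. As [16 <= (4/3)^10], this gives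
    [16^m <= (1 / eps)^10], and the 16th power of this bound yields the exponent 160; the factor
    [16^(16 + 6)] remains. *)
Lemma budget_exists eps : 0 < eps -> eps <= 1 / 2 ->
  exists2 m : nat, (3 / 4) ^+ m < eps & (16 ^ (16 * m + 6))%:R <= 16 ^+ 22 * (1 / eps) ^+ 160.
Proof.
move=> e0 e1; have ex : exists k, (3 / 4) ^+ k < eps.
  exists (Num.bound (3 / eps)).
  have hb : 3 / eps < (Num.bound (3 / eps))%:R by apply: archi_boundP; rewrite divr_ge0 // ltW.
  set k := Num.bound _ in hb *.
  (* Bernoulli's inequality shows that the powers of [4/3] exceed [1 / eps]. *)
  have bern j : 1 + j%:R / 3 <= (4 / 3) ^+ j :> R.
    elim: j => [|j IH]; first by rewrite expr0; lra.
    have j0 : 0 <= j%:R :> R by [].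
    by rewrite exprS -natr1; lra.
  have h : 1 / eps < (4 / 3) ^+ k.
    have := bern k; rewrite ltr_pdivrMr // in hb *; rewrite ltr_pdivrMr // => hk.
    nra.
  have -> : 3 / 4 = (4 / 3)^-1 :> R by field.
  have q0 : 0 < (4 / 3) ^+ k :> R by apply: exprn_gt0; lra.
  by rewrite exprVn invf_plt ?posrE // -div1r.
case: (ex_minnP ex) => -[|m]; first by rewrite expr0; lra.
move=> hm /(_ m) hmin; exists m.+1 => //.
have {hmin} : eps <= (3 / 4) ^+ m by rewrite leNgt; apply/negP => /hmin; rewrite ltnn.
move=> he; have inv : (4 / 3) ^+ m <= 1 / eps :> R.
  have q0 : 0 <= (4 / 3) ^+ m :> R by apply: exprn_ge0; lra.
  rewrite ler_pdivlMr //; apply: le_trans (ler_wpM2l q0 he) _.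
  by rewrite -exprMn (_ : 4 / 3 * (3 / 4) = 1) ?expr1n //; field.
have h16 : 16 ^+ m <= (1 / eps) ^+ 10 :> R.
  apply: le_trans (_ : ((4 / 3) ^+ m) ^+ 10 <= _); last first.
    by rewrite lerXn2r ?nnegrE ?exprn_ge0 ?divr_ge0 // ltW.
  have q16 : 16 <= (4 / 3) ^+ 10 :> R by rewrite !exprS expr0; lra.
  by rewrite exprAC; apply: lerXn2r q16; rewrite nnegrE; lra.
have -> : (16 * m.+1 + 6 = 22 + m * 16)%N by lia.
rewrite natrX exprD exprM ler_wpM2l ?exprn_ge0 //.
have -> : 160%N = (10 * 16)%N by [].
by rewrite exprM lerXn2r ?nnegrE ?exprn_ge0 ?divr_ge0 // ltW.
Qed.

Lemma stuck_count n (F : cnf n) m eps : all (@normal n) F -> (3 / 4) ^+ m < eps ->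
    search_stuck (16 * m + 6) F ->
  (nsat (fun a => sat_cnf a F))%:R < (1 / 2 + eps) * 2 ^+ n.
Proof.
move=> normF hm [p [c [rp cr sc]]].
have := reach_stuck normF erefl rp cr sc.
rewrite -(ler_nat R) !natrM natrD natrM !natrX.
have p4 : 0 < 4 ^+ m :> R by rewrite exprn_gt0.
have p2 : 0 < 2 ^+ n :> R by rewrite exprn_gt0.
rewrite expr_div_n ltr_pdivrMr // in hm.
move: (_%:R) => x h; rewrite -(ltr_pM2r p4).
have : 2 ^+ n * 3 ^+ m < 2 ^+ n * (eps * 4 ^+ m) by rewrite ltr_pM2l.
nra.
Qed.

End Budget.

Local Open Scope ring_scope.

Theorem theorem4p3 (R : realType) :
  exists p : {poly {poly R}},
  forall eps : R, 0 < eps -> eps <= 1 / 2 ->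
  exists P : program,
  forall (n : nat) (f : cnf n), is_3cnf f ->
  exists (out : tree) (t : nat),
    [/\ runs P (enc_cnf f) out t,
        t%:R <= p.[(1 / eps)%:P].[n%:R],
        (1 / 2 + eps) * 2 ^+ n <= (count_sat f)%:R ->
          answers_yes_with out (count_sat f) &
        (count_sat f)%:R < (1 / 2 + eps) * 2 ^+ n ->
          answers_no out].
Proof.
(* The outer variable stands for [1 / eps], that of the coefficient [q] for [n]; the constants are
   those of [budget_exists] and [main_time]. *)
pose q : {poly R} := (16 ^+ 22 * (800 * 130)%:R)%:P * ('X + 1) ^+ 5.
exists (q%:P * 'X^160) => eps e0 e1.
have [m hm hB] := budget_exists e0 e1.
(* The bound on the number of summands does not involve [n], so [rs] can be fixed before [n]. *)
have [rs hrs] : exists rs, forall n ds bs, (size ds <= 8 ^ (16 * m + 6))%N ->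
    all (fun d => d <= n)%N ds -> size bs = n.+1 ->
    bits_value bs = (\sum_(d <- ds) 2 ^ d)%N ->
  lexi_gt rs (rev bs) = ((1 / 2 + eps) * 2 ^+ n <= (bits_value bs)%:R).
  by apply: threshold; lra.
exists (the_program (16 * m + 6) rs) => n f f3.
have [out [[t tT ht] res]] := main_calls (16 * m + 6) rs f3.
exists out, t; split=> //.
- rewrite hornerM hornerC hornerXn hornerM horner_exp hornerC.
  rewrite /q hornerM horner_exp hornerD hornerX !hornerC.
  apply: (@le_trans _ _ (16 ^ (16 * m + 6) * (800 * 130) * n.+1 ^ 5)%N%:R).
    by rewrite ler_nat.
  have -> : (16 ^ (16 * m + 6) * (800 * 130) * n.+1 ^ 5)%N%:R =
      (16 ^ (16 * m + 6))%:R * ((800 * 130)%:R * (n%:R + 1) ^+ 5) :> R.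
    by rewrite natr1 -natrX -!natrM -mulnA.
  have mono (a b c d e : R) : 0 <= c * d -> a <= b * e -> a * (c * d) <= b * c * d * e.
    by move=> cd ab; rewrite -(mulrA b) mulrAC ler_wpM2r.
  by apply: mono hB; rewrite mulr_ge0 // exprn_ge0 // addr_ge0.
- case: res => [[-> st]|[ds [bs [sd nd sb vb [-> ->]]]]].
    move=> h; have := stuck_count (normalize_normal (proj2 (andP f3))) hm st.
    by rewrite -count_satE ltNge h.
  by rewrite -(hrs _ _ _ sd nd sb vb) => ->; exists (enc_seq enc_bool bs) => //; exists bs.
case: res => [[-> //]|[ds [bs [sd nd sb vb [-> ->]]]]].
by rewrite ltNge -(hrs _ _ _ sd nd sb vb) => /negbTE ->.
Qed.
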